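(* Let $(M^4,g_0)$ be a closed connected four-dimensional Riemannian manifold whose Weyl tensor vanishes nowhere, let $a,c\in C^\infty(M)$ with $a>0$ on $M$, put $Lv=-\operatorname{div}(a\nabla v)+c\,v$, and assume that the first eigenvalue $\lambda_1$ of $L$ satisfies $\lambda_1\ge0$. Suppose that $u_1,u_2\in C^2(M)$, with $u_1>0$ and $u_2>0$ in $M$, are both solutions $u$ of the equation $$Lu=\mathfrak D(u)\left(\int_Mu^{-4}\,dV\right)^{-\frac32}u^{-5}\quad\text{in } M.$$ Then there exists $\beta\in\mathbb R$, $\beta>0$, such that $u_1=\beta u_2$ in $M$.
   Context: All geometric quantities ($\nabla$, $\operatorname{div}$, norms, $dV$) refer to $g_0$. The first eigenvalue is $$\lambda_1=\inf_{u\in H^1(M),\,u\not\equiv0}\frac{\int_M(a|\nabla u|^2+c\,u^2)\,dV}{\int_Mu^2\,dV},$$ and $$\mathfrak D(u)=\left(\int_Mu^{-4}\,dV\right)^{\frac12}\int_M(a|\nabla u|^2+c\,u^2)\,dV.$$ *)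

(* Defs.v *)
(* MathComp / MathComp-Analysis *)
From HB Require Import structures.
From mathcomp Require Import all_boot all_order all_algebra.
From mathcomp Require Import all_classical all_reals all_analysis measurable_realfun.

Set Implicit Arguments.
Unset Strict Implicit.
Unset Printing Implicit Defensive.

Import Order.TTheory GRing.Theory Num.Theory.
Import numFieldNormedType.Exports.

Local Open Scope classical_set_scope.
Local Open Scope ring_scope.

Section Calculus.
Variable R : realType.
Implicit Types (U : set 'rV[R]_4) (f : 'rV[R]_4 -> R).

Definition partial (i : 'I_4) f (x : 'rV[R]_4) : R := 'D_(delta_mx 0 i) f x.

(* Only meant for open U. *)
Fixpoint Ck_on (k : nat) U f : Prop :=
  (forall x, U x -> {for x, continuous f}) /\
  if k is k'.+1 then
    forall i, (forall x, U x -> derivable f x (delta_mx 0 i)) /\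
              Ck_on k' U (partial i f)
  else True.

Definition smooth_on U f := forall k, Ck_on k U f.

Definition vec4 (t : R * R * R * R) : 'rV[R]_4 :=
  \row_(i < 4) [:: t.1.1.1; t.1.1.2; t.1.2; t.2]`_i.

Local Notation RM := (measurableTypeR R).

Definition leb4 : {measure set (RM * RM * RM * RM)%type -> \bar R} :=
  (((@lebesgue_measure R \x @lebesgue_measure R)
    \x @lebesgue_measure R) \x @lebesgue_measure R)%E.

Definition Rint4 U f : R := \int[leb4]_(t in [set t | U (vec4 t)]) f (vec4 t).

Definition test_function U f :=
  smooth_on setT f /\
  exists K, [/\ compact K, K `<=` U & forall x, ~ K x -> f x = 0].

End Calculus.

(* Local tensor calculus: G is the matrix (g_ij) of the metric in the
   coordinates of a chart. *)
Section LocalGeometry.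
Variable R : realType.
Variable G : 'rV[R]_4 -> 'M[R]_4.
Implicit Types (i j k l m : 'I_4) (x : 'rV[R]_4).

Definition metric_inv x i j : R := invmx (G x) i j.

Definition christoffel k i j x : R :=
  2^-1 * \sum_l metric_inv x k l *
    (partial i (fun y => G y j l) x + partial j (fun y => G y i l) x
     - partial l (fun y => G y i j) x).

(* The component R^l_{kij}: R(d_i, d_j) d_k = R^l_{kij} d_l. *)
Definition riemann_up l k i j x : R :=
  partial i (christoffel l j k) x - partial j (christoffel l i k) x
  + \sum_m (christoffel l i m x * christoffel m j k x
            - christoffel l j m x * christoffel m i k x).

Definition riemann l k i j x : R := \sum_m G x l m * riemann_up m k i j x.

Definition ricci k j x : R := \sum_i riemann_up i k i j x.

Definition scalar_curvature x : R :=
  \sum_k \sum_j metric_inv x k j * ricci k j x.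

(* In dimension n the two coefficients are 1/(n-2) and 1/((n-1)(n-2)). *)
Definition weyl l k i j x : R :=
  riemann l k i j x
  - 2^-1 * (G x l i * ricci k j x - G x l j * ricci k i x
            + G x k j * ricci l i x - G x k i * ricci l j x)
  + 6^-1 * scalar_curvature x * (G x l i * G x k j - G x l j * G x k i).

Definition volume_density x : R := Num.sqrt (\det (G x)).

Definition gradient_loc (v : 'rV[R]_4 -> R) x : 'rV[R]_4 :=
  \row_i \sum_j metric_inv x i j * partial j v x.

Definition divergence_loc (X : 'rV[R]_4 -> 'rV[R]_4) x : R :=
  (volume_density x)^-1 *
  \sum_i partial i (fun y => volume_density y * X y 0 i) x.

End LocalGeometry.

(* cmap and cinv are only meaningful on cdom and cmap @` cdom. *)
Record chart (R : realType) (M : ptopologicalType) := Chart {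
  cdom : set M ;
  cmap : M -> 'rV[R]_4 ;
  cinv : 'rV[R]_4 -> M }.

Notation borel M := (g_sigma_algebraType (@open M)).

Section Manifold.
Variables (R : realType) (M : ptopologicalType).
Implicit Types (phi psi : chart R M) (A : set (chart R M)).

Definition cimg phi : set 'rV[R]_4 := cmap phi @` cdom phi.

Definition is_chart phi :=
  [/\ open (cdom phi), open (cimg phi),
      forall p, cdom phi p -> cinv phi (cmap phi p) = p,
      {within cdom phi, continuous (cmap phi)} &
      {within cimg phi, continuous (cinv phi)}].

Definition transition phi psi : 'rV[R]_4 -> 'rV[R]_4 := cmap psi \o cinv phi.

Definition smooth_atlas A :=
  [/\ forall phi, A phi -> is_chart phi,
      forall p, exists2 phi, A phi & cdom phi p &
      forall phi psi, A phi -> A psi -> forall j,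
        smooth_on (cmap phi @` (cdom phi `&` cdom psi))
                  (fun x => transition phi psi x 0 j)].

Definition closed_connected_manifold A :=
  [/\ hausdorff_space M, @second_countable M, compact [set: M],
      connected [set: M] & smooth_atlas A].

Definition Ck_fun A (k : nat) (u : M -> R) :=
  forall phi, A phi -> Ck_on k (cimg phi) (u \o cinv phi).

Definition smooth_fun A (u : M -> R) := forall k, Ck_fun A k u.

(* Entry (i, j) is d_i (psi o phi^-1)^j. *)
Definition transition_jac phi psi (x : 'rV[R]_4) : 'M[R]_4 :=
  \matrix_(i, j) partial i (fun y => transition phi psi y 0 j) x.

(* A tensor field is given by its components in each chart, as functions of
   the coordinates of that chart, subject to the transformation rule. *)
Definition riemannian_metric A (g : chart R M -> 'rV[R]_4 -> 'M[R]_4) :=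
  [/\ forall phi, A phi -> forall i j,
        smooth_on (cimg phi) (fun x => g phi x i j),
      forall phi x, A phi -> cimg phi x -> (g phi x)^T = g phi x,
      forall phi x (v : 'rV[R]_4), A phi -> cimg phi x -> v != 0 ->
        0 < (v *m g phi x *m v^T) 0 0 &
      forall phi psi p, A phi -> A psi -> cdom phi p -> cdom psi p ->
        let J := transition_jac phi psi (cmap phi p) in
        g phi (cmap phi p) = J *m g psi (cmap psi p) *m J^T].

Definition covector_field A (w : chart R M -> 'rV[R]_4 -> 'rV[R]_4) :=
  forall phi psi p, A phi -> A psi -> cdom phi p -> cdom psi p ->
    w phi (cmap phi p) =
    w psi (cmap psi p) *m (transition_jac phi psi (cmap phi p))^T.

Definition differential (u : M -> R) : chart R M -> 'rV[R]_4 -> 'rV[R]_4 :=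
  fun phi x => \row_i partial i (u \o cinv phi) x.

(* |w|^2 = g^{ij} w_i w_j, computed in some chart around p; by the
   transformation rules the value does not depend on the chart. *)
Definition sqnorm A (g : chart R M -> 'rV[R]_4 -> 'M[R]_4)
    (w : chart R M -> 'rV[R]_4 -> 'rV[R]_4) (p : M) : R :=
  xget 0 [set r | exists phi, [/\ A phi, cdom phi p &
    r = \sum_i \sum_j metric_inv (g phi) (cmap phi p) i j
          * w phi (cmap phi p) 0 i * w phi (cmap phi p) 0 j]].

Definition weyl_nowhere_zero A (g : chart R M -> 'rV[R]_4 -> 'M[R]_4) :=
  forall phi p, A phi -> cdom phi p ->
    exists l k i j, weyl (g phi) l k i j (cmap phi p) != 0.

(* The Riemannian measure dV is the (unique) Borel measure given by
   sqrt(det g_ij) dx^1 dx^2 dx^3 dx^4 in every chart. *)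
Definition riemannian_volume A (g : chart R M -> 'rV[R]_4 -> 'M[R]_4)
    (mu : {measure set (borel M) -> \bar R}) :=
  forall phi, A phi -> forall f : borel M -> \bar R,
    measurable_fun (cdom phi : set (borel M)) f ->
    (forall p, cdom phi p -> (0 <= f p)%E) ->
    (\int[mu]_(p in (cdom phi : set (borel M))) f p =
     \int[@leb4 R]_(t in [set t | cimg phi (vec4 t)])
        (f (cinv phi (vec4 t)) * (volume_density (g phi) (vec4 t))%:E))%E.

Section Operator.
Variables (A : set (chart R M)) (g : chart R M -> 'rV[R]_4 -> 'M[R]_4).
Variable mu : {measure set (borel M) -> \bar R}.
Variables a c : M -> R.
Implicit Types (u : M -> R) (w : chart R M -> 'rV[R]_4 -> 'rV[R]_4).

Definition weak_differential u w :=
  covector_field A w /\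
  forall phi, A phi -> forall i (eta : 'rV[R]_4 -> R),
    test_function (cimg phi) eta ->
    Rint4 (cimg phi) (fun x => u (cinv phi x) * partial i eta x) =
    - Rint4 (cimg phi) (fun x => w phi x 0 i * eta x).

(* u belongs to H^1(M), with weak differential w. *)
Definition sobolev_H1 u w :=
  [/\ measurable_fun setT (u : borel M -> R),
      forall phi i, A phi -> measurable_fun (cdom phi : set (borel M))
        (fun p : borel M => w phi (cmap phi p) 0 i : R),
      mu.-integrable setT (fun p : borel M => (u p ^+ 2)%:E),
      mu.-integrable setT (fun p : borel M => (sqnorm A g w p)%:E) &
      weak_differential u w].

(* int_M (a |w|^2 + c u^2) dV, where w is the differential of u. *)
Definition energy u w : R :=
  \int[mu]_p (a p * sqnorm A g w p + c p * u p ^+ 2).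

Definition first_eigenvalue : \bar R :=
  ereal_inf [set q : \bar R | exists u w,
    [/\ sobolev_H1 u w, ~ {ae mu, forall p, u p = 0} &
        q = (energy u w / \int[mu]_p (u p ^+ 2))%:E]].

Definition int_pow_m4 u : R := \int[mu]_p (u p ^- 4).

Definition frakD u : R :=
  int_pow_m4 u `^ (1 / 2) * energy u (differential u).

(* L v = - div (a grad v) + c v, in the coordinates of phi. *)
Definition Lop phi (v : M -> R) (x : 'rV[R]_4) : R :=
  - divergence_loc (g phi)
      (fun y => a (cinv phi y) *: gradient_loc (g phi) (v \o cinv phi) y) x
  + c (cinv phi x) * v (cinv phi x).

Definition solves_equation u :=
  forall phi p, A phi -> cdom phi p ->
    Lop phi u (cmap phi p) =
    frakD u * int_pow_m4 u `^ (- (3 / 2)) * u p ^- 5.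

End Operator.
End Manifold.

(* Main.v *)
Require Import Defs.
From HB Require Import structures.
From mathcomp Require Import all_boot all_order all_algebra.
From mathcomp Require Import all_classical all_reals all_analysis measurable_realfun.
From mathcomp Require Import ring lra.

(** Both solutions satisfy an equation L u = K(u) u^-5, where the constant
    K(u) = E(u) / \int u^-4 has the sign of the energy
    E(u) = \int (a |grad u|^2 + c u^2).  They are compared pointwise.

    Let m be the maximum of u1 / u2, attained at p.  The function u1 - m u2 is
    nonpositive and vanishes at p, so at p its gradient is zero, its Hessian is
    nonpositive and the zero-order term of L drops out: L u1 >= m L u2 there,
    which reads m^6 K(u2) <= K(u1) ([touching_coefficients]).  Exchanging the
    roles, the maximum n of u2 / u1 satisfies n^6 K(u1) <= K(u2).  Hence
    (m n)^6 K(u2) <= K(u2).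

    The assumption on the first eigenvalue gives K(u2) >= 0, because u2 is an
    admissible function in the infimum ([energy_ge0]).  If K(u2) > 0, then
    m n <= 1, so that u2 <= n u1 <= u1 / m, that is u1 >= m u2, and u1 = m u2.
    If K(u2) = 0, the two inequalities force K(u1) = 0; then u1 - m u2 solves
    the linear equation L z = 0, is nonpositive and vanishes somewhere, so the
    strong maximum principle and connectedness make it vanish everywhere
    ([strong_comparison]).

    Two bodies of theory carry this.  The strong maximum principle
    ([strong_maximum]) is E. Hopf's: a Gaussian barrier at a point where a ball
    of negativity touches the zero set, and the second derivative test for
    elliptic operators ([local_max_elliptic]), which rests on a Cholesky
    factorization.  The zero-order term is kept in the argument: it is harmless
    at a zero of z, so no quotient u1 / u2 has to be differentiated.

    Admissibility of a C^1 function u ([sobolev_H1_C1]) means that its classical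
    differential is a covector field (chain rule), that it is the weak
    differential in each chart (integration by parts against test functions, by
    Fubini and the fundamental theorem of calculus), and that u^2 and |du|^2
    are integrable, which follows from continuity because the volume of a
    compact manifold is finite ([volume_finite]). *)

Set Implicit Arguments.
Unset Strict Implicit.
Unset Printing Implicit Defensive.

Import Order.TTheory GRing.Theory Num.Theory.
Import numFieldNormedType.Exports.

Local Open Scope classical_set_scope.
Local Open Scope ring_scope.

(** * One real variable: mean value bound and second derivative test *)
Section OneVariable.
Variable R : realType.

(** Reduces directional derivatives to derivatives of one real variable. *)
Lemma is_derive_line (V : normedModType R) (f : V -> R) (x v : V) (s : R) :
  derivable f (x + s *: v) v ->
  is_derive s 1 (fun t : R => f (x + t *: v)) ('D_v f (x + s *: v)).
Proof.
have E : (fun h : R => h^-1 *: ((f \o shift (x + s *: v)) (h *: v) - f (x + s *: v)))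
  = (fun h : R => h^-1 *: (((fun t : R => f (x + t *: v)) \o shift s) (h *: 1) -
       f (x + s *: v))).
  by apply/funext => h /=; rewrite [h%:A]mulr1 scalerDl addrCA.
by move=> df; split; rewrite /derivable /derive -E.
Qed.

Lemma near0_ball (P : set R) : (\forall t \near (0:R), P t) ->
  exists2 d : R, 0 < d & forall t, `|t| < d -> P t.
Proof.
move=> /nbhs_ballP[d /= d0 dP]; exists d => // t td; apply: dP.
by rewrite -ball_normE/= sub0r normrN.
Qed.

(** The mean value theorem; h may have either sign, hence the two cases. *)
Lemma mean_value_approx (f df : R -> R) (L e h : R) :
  (forall s : R, `|s| <= `|h| -> is_derive s 1 f (df s)) ->
  (forall s : R, `|s| <= `|h| -> `|df s - L| <= e) ->
  `|f h - f 0 - h * L| <= e * `|h|.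
Proof.
move=> fd fL.
have cont a b : (forall x, a <= x <= b -> `|x| <= `|h|) ->
    {within `[a, b], continuous f}.
  move=> ab; apply: derivable_within_continuous => x; rewrite in_itv/= => /ab/fd.
  by case.
have [h0|h0] := leP 0 h.
- have [|/=|c] := @MVT_segment R f df 0 h h0.
  + move=> x; rewrite in_itv/= => /andP[x0 xh]; apply: fd.
    by rewrite (ger0_norm h0) (ger0_norm (ltW x0)) ltW.
  + by apply: cont => x /andP[x0 xh]; rewrite !ger0_norm.
  rewrite in_itv/= subr0 => /andP[c0 ch] ->.
  rewrite [h * L]mulrC -mulrBl normrM ler_wpM2r//.
  by apply: fL; rewrite !ger0_norm.
- have [|/=|c] := @MVT_segment R f df h 0 (ltW h0).
  + move=> x; rewrite in_itv/= => /andP[x0 xh]; apply: fd.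
    by rewrite (ltr0_norm h0) (ltr0_norm xh) lerN2 ltW.
  + by apply: cont => x /andP[x0 xh]; rewrite (ltr0_norm h0) ler0_norm// lerN2.
  rewrite in_itv/= sub0r => /andP[c0 ch] fE.
  rewrite (_ : f h - f 0 - h * L = - (f 0 - f h + h * L)); last by ring.
  rewrite fE (_ : - _ = (df c - L) * h); last by ring.
  rewrite normrM ler_wpM2r//.
  by apply: fL; rewrite (ltr0_norm h0) ler0_norm// lerN2.
Qed.

(** If l were positive, df would be positive just to the right of 0, since
    df 0 = 0, and f would exceed f 0 there by the mean value theorem.  Only the
    derivative of df at the single point 0 is available, so no Taylor formula is
    used. *)
Lemma second_derivative_at_max (f df : R -> R) (l d : R) : 0 < d ->
  (forall s : R, `|s| < d -> is_derive s 1 f (df s)) ->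
  (forall s : R, `|s| < d -> f s <= f 0) ->
  is_derive (0:R) 1 df l ->
  df 0 = 0 /\ l <= 0.
Proof.
move=> d0 fd fmax dfl.
have df0 : df 0 = 0.
  have h0 : is_derive (0:R) 1 f 0.
    apply: (@derive1_at_max R f (- d) d 0) => //.
    - by rewrite ge0_cp// ltW.
    - by move=> t; rewrite in_itv/= -ltr_norml => /fd [].
    - by rewrite in_itv/= oppr_lt0 d0.
    - by move=> t; rewrite in_itv/= -ltr_norml => /fmax.
  have := fd 0; rewrite normr0 => /(_ d0) h1.
  by rewrite -(@derive_val _ _ _ _ _ _ _ h1) (@derive_val _ _ _ _ _ _ _ h0).
split => //; rewrite leNgt; apply/negP => l0.
have [ex dl] := dfl.
have cv : (fun h : R => h^-1 * df h) @ 0^' --> l.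
  have := ex; rewrite /derivable => cvx.
  move: dl; rewrite /derive => dl.
  have : (fun h : R => h^-1 *: ((df \o shift 0) (h *: 1) - df 0)) @ 0^' --> l.
    by rewrite -dl; exact: cvx.
  rewrite (_ : (fun h : R => h^-1 *: ((df \o shift 0) (h *: 1) - df 0)) =
            (fun h : R => h^-1 * df h))//.
  by apply/funext => h /=; rewrite df0 subr0 addr0 [h%:A]mulr1.
have : \forall h \near (0:R)^', 0 < h^-1 * df h by apply: (cvgr_gt l).
rewrite near_withinE => /near0_ball[e e0 he].
pose m := Num.min (d/2) (e/2).
have m0 : 0 < m by rewrite lt_min !divr_gt0.
have md : m < d by rewrite /m gt_min ltr_pdivrMr// ltr_pMr// ltr1n.
have me : m < e.
  by rewrite /m gt_min [X in _ || X]ltr_pdivrMr// [X in _ || X]ltr_pMr// ltr1n orbT.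
have [|/=|c] := @MVT R f df 0 m m0.
- move=> x; rewrite in_itv/= => /andP[x0 xm]; apply: fd.
  by rewrite gtr0_norm// (lt_trans xm).
- apply: derivable_within_continuous => x; rewrite in_itv/= => /andP[x0 xm].
  have [] // := fd x.
  by rewrite ger0_norm// (le_lt_trans xm).
rewrite in_itv/= subr0 => /andP[c0 cm] fE.
have : 0 < c^-1 * df c.
  apply: he; last by rewrite gt_eqF.
  by rewrite gtr0_norm// (lt_trans cm).
rewrite pmulr_rgt0 ?invr_gt0// => dc.
have := fmax m; rewrite gtr0_norm// => /(_ md); rewrite -subr_le0 fE leNgt.
by rewrite mulr_gt0.
Qed.

End OneVariable.

(** * Continuous partial derivatives imply differentiability *)
Section Calculus4.
Variable R : realType.
Implicit Types (U : set 'rV[R]_4) (f g : 'rV[R]_4 -> R) (x v : 'rV[R]_4).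

Local Notation e i := (delta_mx 0 i : 'rV[R]_4).

Lemma rV_norm_coord x i : `|x 0 i| <= `|x|.
Proof.
by rewrite [leRHS]/Num.norm/= mx_normrE; apply: (le_bigmax _ _ (0, i)).
Qed.

Lemma rV_norm_lt x d : 0 < d -> (forall i, `|x 0 i| < d) -> `|x| < d.
Proof.
move=> d0 H; rewrite /Num.norm/= mx_normrE; apply/bigmax_ltP; split => //.
by move=> [i j] _ /=; rewrite ord1.
Qed.

Lemma compact_norm_ball (x0 : 'rV[R]_4) r : compact [set x | `|x0 - x| <= r].
Proof.
apply: bounded_closed_compact.
  exists (`|x0| + r); split; first exact: num_real.
  move=> m rm x xr /=; rewrite (le_trans _ (ltW rm))// -[x in `|x|](subKr x0).
  by rewrite (le_trans (ler_normB _ _))// lerD2l.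
apply: (@preimage_closed _ _ (fun x : 'rV[R]_4 => `|x0 - x|) [set t | t <= r]).
  move=> x _; apply: (@cvg_norm _ _ _ (nbhs x) _ (fun y => x0 - y) (x0 - x)).
  by apply: cvgB; [exact: cvg_cst|exact: cvg_id].
exact: closed_le.
Qed.

Lemma sum_funE (I : Type) (r : seq I) (F : I -> 'rV[R]_4 -> R) :
  (fun x => \sum_(i <- r) F i x) = \sum_(i <- r) F i.
Proof. by apply/funext => x; rewrite fct_sumE. Qed.

Lemma rV4_basisE v : v = \sum_i v 0 i *: e i.
Proof. exact: row_sum_delta. Qed.

Lemma directional_derivativeE f x : differentiable f x -> forall v,
  'D_v f x = \sum_i v 0 i * partial i f x.
Proof.
move=> df v; rewrite deriveE// {1}[v]rV4_basisE linear_sum/=.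
by apply: eq_bigr => i _; rewrite linearZ/= /partial deriveE.
Qed.

Lemma continuous_lin_form (c : 'I_4 -> R) :
  continuous (fun h : 'rV[R]_4 => \sum_i h 0 i * c i).
Proof.
move=> x; apply: differentiable_continuous; rewrite sum_funE.
apply: differentiable_sum => i; apply: differentiableM => //.
exact: differentiable_coord.
Qed.

(** Vertices of the path from x to x + h that moves along one coordinate axis
    at a time. *)
Definition stair x (h : 'rV[R]_4) (k : nat) : 'rV[R]_4 :=
  x + \row_i (if (i < k)%N then h 0 i else 0).

Lemma stairS x h (i : 'I_4) : stair x h i.+1 = stair x h i + h 0 i *: e i.
Proof.
rewrite /stair -addrA; congr (_ + _); apply/rowP => j; rewrite !mxE eqxx/=.
rewrite ltnS leq_eqVlt val_eqE; have [->|ji] := eqVneq j i.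
  by rewrite /= ltnn add0r mulr1.
by rewrite /= mulr0 addr0.
Qed.

(** The increment f (x + h) - f x is split along the path [stair]; on each edge
    only one coordinate varies, and the mean value theorem compares the
    increment with the partial derivative at x. *)
Lemma differentiable_of_partials U f : open U ->
  (forall x i, U x -> derivable f x (e i)) ->
  (forall x i, U x -> {for x, continuous (partial i f)}) ->
  forall x, U x -> differentiable f x.
Proof.
move=> oU fd fc x Ux.
pose lf (h : 'rV[R]_4) : R := \sum_i h 0 i * partial i f x.
have lin : linear lf.
  move=> a u v; rewrite /lf scaler_sumr -big_split/=; apply: eq_bigr => i _.
  by rewrite !mxE mulrDl -mulrA.
pose lM := GRing.isLinear.Build _ _ _ _ _ lin.
pose L : {linear 'rV[R]_4 -> R} := HB.pack lf lM.
have Lc : continuous L by exact: continuous_lin_form.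
have main (eps : R) : 0 < eps ->
    \forall h \near (0 : 'rV[R]_4), `|f (h + x) - (f x + L h)| <= eps * `|h|.
  move=> eps0.
  have e4 : 0 < eps / 4 by rewrite divr_gt0.
  have : \forall y \near x, U y /\
      forall i : 'I_4, `|partial i f y - partial i f x| <= eps / 4.
    near=> y; split.
      by near: y; exact: open_nbhs_nbhs.
    near: y; apply: filter_forall => i.
    have := fc x i Ux; move=> /cvgrPdist_le /(_ _ e4).
    by apply: filterS => y; rewrite distrC.
  move=> /nbhs_ballP[d /= d0 dP].
  apply/nbhs_ballP; exists d => //= h; rewrite -ball_normE/= sub0r normrN => hd.
  (* The norm is the sup norm, so the whole path stays in the ball of radius |h|. *)
  have inball k (s : R) (i : 'I_4) : (k <= i)%N -> `|s| <= `|h 0 i| ->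
      ball x d (stair x h k + s *: e i).
    move=> ki sh; rewrite -ball_normE/= /stair opprD opprD addrA addrA subrr sub0r.
    rewrite -opprD normrN; apply: rV_norm_lt => // j; rewrite !mxE eqxx/=.
    apply: le_lt_trans hd; case: ifPn => jk.
      have ji : (j == i) = false by rewrite -val_eqE ltn_eqF// (leq_trans jk).
      by rewrite ji mulr0 addr0 rV_norm_coord.
    have [_|ji] := eqVneq j i; last by rewrite mulr0 addr0 normr0.
    by rewrite mulr1 add0r (le_trans sh)// rV_norm_coord.
  have -> : f (h + x) - (f x + L h) =
     \sum_(i < 4) (f (stair x h i.+1) - f (stair x h i) - h 0 i * partial i f x).
    rewrite sumrB -(big_mkord xpredT (fun i => f (stair x h i.+1) - f (stair x h i))).
    rewrite telescope_sumr//= opprD addrA; congr (_ - f _ - _).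
      rewrite addrC /stair; congr (f (_ + _)); apply/rowP => j.
      by rewrite !mxE ltn_ord.
    rewrite /stair -[LHS]addr0; congr (_ + _); apply/rowP => j.
    by rewrite !mxE.
  apply: (le_trans (ler_norm_sum _ _ _)).
  have -> : eps * `|h| = \sum_(i < 4) (eps / 4 * `|h|).
    by rewrite sumr_const card_ord -mulr_natr; field.
  apply: ler_sum => i _.
  apply: (@le_trans _ _ (eps / 4 * `|h 0 i|)); last first.
    by rewrite ler_wpM2l ?rV_norm_coord// ltW.
  pose phi t := f (stair x h i + t *: e i).
  have -> : f (stair x h i.+1) = phi (h 0 i) by rewrite /phi stairS.
  have -> : f (stair x h i) = phi 0 by rewrite /phi scale0r addr0.
  apply: (@mean_value_approx R phi (fun t => partial i f (stair x h i + t *: e i))).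
  - move=> s sh; apply: is_derive_line; apply: fd.
    by have [] := dP _ (inball _ _ _ (leqnn i) sh).
  - move=> s sh.
    by have [_] := dP _ (inball _ _ _ (leqnn i) sh); apply.
have dE : 'd f x = L :> (_ -> _).
  by apply: diff_unique => //; apply/eqaddoP => eps /main.
apply/diff_locallyP; rewrite dE; split => //.
by apply/eqaddoP => eps /main.
Unshelve. all: by end_near. Qed.

End Calculus4.

(** * Functions of class C^1 near a point *)
Lemma near_eq_continuous (T T' : topologicalType) (f g : T -> T') (x : T) :
  (\forall y \near x, f y = g y) ->
  {for x, continuous g} -> {for x, continuous f}.
Proof.
move=> fg gc; rewrite /prop_for /continuous_at (nbhs_singleton fg).
move=> P /gc gP; rewrite /nbhs/=.
by apply: filterS2 fg gP => y /= ->.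
Qed.

Section C1.
Variable R : realType.
Implicit Types (U : set 'rV[R]_4) (f g : 'rV[R]_4 -> R) (x v : 'rV[R]_4).

Local Notation e i := (delta_mx 0 i : 'rV[R]_4).

(** The coefficients of the operator contain first derivatives of the metric;
    their continuity at a point is read off from this property, which is stable
    under the algebraic operations below. *)
Definition C1_at f x :=
  (\forall y \near x, differentiable f y) /\
  forall i, {for x, continuous (partial i f)}.

Lemma C1_at_diff f x : C1_at f x -> differentiable f x.
Proof. by case=> /nbhs_singleton. Qed.

Lemma C1_at_continuous f x : C1_at f x -> {for x, continuous f}.
Proof. by move=> /C1_at_diff/differentiable_continuous. Qed.

Lemma near_eq_differentiable f g x : (\forall y \near x, f y = g y) ->
  differentiable f x -> differentiable g x.
Proof.
move=> fg df.
have lin (eps : R) : 0 < eps ->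
    \forall h \near (0 : 'rV[R]_4), `|g (h + x) - (g x + 'd f x h)| <= eps * `|h|.
  move=> eps0; have /eqaddoP/(_ eps eps0) := diff_locally df.
  have : \forall h \near (0 : 'rV[R]_4), f (h + x) = g (h + x).
    move: fg => /nbhs_ballP[d /= d0 dP]; apply/nbhs_ballP; exists d => //= h.
    rewrite -ball_normE/= sub0r normrN => hd; apply: dP.
    by rewrite -ball_normE/= opprD addrCA subrr addr0 normrN.
  by apply: filterS2 => h /= <-; rewrite -(nbhs_singleton fg).
have dE : 'd g x = 'd f x :> (_ -> _).
  apply: diff_unique; first exact: diff_continuous.
  by apply/eqaddoP => eps /lin.
apply/diff_locallyP; rewrite dE; split; first exact: diff_continuous.
by apply/eqaddoP => eps /lin.
Qed.

Lemma near_eq_partial i f g x : (\forall y \near x, f y = g y) ->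
  \forall y \near x, partial i f y = partial i g y.
Proof. by move=> /near_join; apply: filterS => y; exact: near_eq_derive. Qed.

Lemma partial_near_eq0 i f x : (\forall y \near x, f y = 0) -> partial i f x = 0.
Proof.
move=> f0; rewrite /partial -[RHS](derive_cst (0 : R) x (delta_mx 0 i)).
exact: near_eq_derive.
Qed.

Lemma C1_at_near_eq f g x : (\forall y \near x, f y = g y) ->
  C1_at f x -> C1_at g x.
Proof.
move=> fg [df cf]; split.
  by apply: filterS2 (near_join fg) df => y; exact: near_eq_differentiable.
move=> i; apply: near_eq_continuous (cf i).
by apply: filterS (near_eq_partial i fg) => y ->.
Qed.

Lemma C1_at_cst (k : R) x : C1_at (fun=> k) x.
Proof.
split; first by near=> y; exact: differentiable_cst.
move=> i; rewrite (_ : partial i _ = fun=> 0); first exact: cst_continuous.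
by apply/funext => y; rewrite /partial derive_cst.
Unshelve. all: by end_near. Qed.

Lemma C1_atD f g x : C1_at f x -> C1_at g x -> C1_at (fun y => f y + g y) x.
Proof.
move=> [df cf] [dg cg]; split.
  by apply: filterS2 df dg => y; exact: differentiableD.
move=> i; apply: (near_eq_continuous (g := fun y => partial i f y + partial i g y)).
  apply: filterS2 df dg => y dfy dgy.
  by rewrite /partial deriveD//; exact: diff_derivable.
exact: (continuousD (cf i) (cg i)).
Qed.

Lemma partialM i f g x : differentiable f x -> differentiable g x ->
  partial i (fun y => f y * g y) x = f x * partial i g x + partial i f x * g x.
Proof.
move=> df dg; rewrite /partial.
rewrite (@deriveM _ _ f g x _ (diff_derivable df) (diff_derivable dg)).
by congr (_ + _); rewrite mulrC.
Qed.

Lemma partial_lincomb i (k : R) f g x : differentiable f x -> differentiable g x ->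
  partial i (fun y => f y + k * g y) x = partial i f x + k * partial i g x.
Proof.
move=> df dg; rewrite /partial.
rewrite (@deriveD _ _ _ f (fun y => k * g y)); [|exact: diff_derivable|].
  by rewrite (@deriveZ _ _ _ g k)//; exact: diff_derivable.
by apply: (@derivableZ _ _ _ g k); exact: diff_derivable.
Qed.

Lemma near_partial_lincomb i (k : R) f g x : C1_at f x -> C1_at g x ->
  \forall y \near x, partial i (fun y => f y + k * g y) y =
    partial i f y + k * partial i g y.
Proof.
by move=> [df _] [dg _]; apply: filterS2 df dg => y; exact: partial_lincomb.
Qed.

Lemma partial2_lincomb i j (k : R) f g x : C1_at f x -> C1_at g x ->
  C1_at (partial j f) x -> C1_at (partial j g) x ->
  partial i (partial j (fun y => f y + k * g y)) x =
  partial i (partial j f) x + k * partial i (partial j g) x.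
Proof.
move=> cf cg cf2 cg2; rewrite {1}/partial.
rewrite (near_eq_derive _ (near_partial_lincomb j k cf cg)).
by apply: partial_lincomb; exact: C1_at_diff.
Qed.

Lemma C1_atM f g x : C1_at f x -> C1_at g x -> C1_at (fun y => f y * g y) x.
Proof.
move=> cf cg; have [df pf] := cf; have [dg pg] := cg; split.
  by apply: filterS2 df dg => y; exact: differentiableM.
move=> i; apply: (near_eq_continuous
    (g := fun y => f y * partial i g y + partial i f y * g y)).
  by apply: filterS2 df dg => y dfy dgy; rewrite partialM.
apply: (@continuousD _ _ _ (fun y => f y * partial i g y)
  (fun y => partial i f y * g y)).
  exact: (continuousM (C1_at_continuous cf) (pg i)).
exact: (continuousM (pf i) (C1_at_continuous cg)).
Qed.

Lemma C1_at_lincomb (k : R) f g x : C1_at f x -> C1_at g x ->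
  C1_at (fun y => f y + k * g y) x.
Proof. by move=> cf cg; exact: (C1_atD cf (C1_atM (C1_at_cst k x) cg)). Qed.

Lemma C1_at_partial_lincomb i (k : R) f g x : C1_at f x -> C1_at g x ->
  C1_at (partial i f) x -> C1_at (partial i g) x ->
  C1_at (partial i (fun y => f y + k * g y)) x.
Proof.
move=> cf cg cf2 cg2.
apply: (@C1_at_near_eq (fun y => partial i f y + k * partial i g y)).
  have := near_partial_lincomb i k cf cg.
  by apply: filterS => y ->.
exact: C1_at_lincomb.
Qed.

Lemma C1_at_sum (I : Type) (r : seq I) (P : pred I) (F : I -> 'rV[R]_4 -> R) x :
  (forall i, P i -> C1_at (F i) x) -> C1_at (fun y => \sum_(i <- r | P i) F i y) x.
Proof.
move=> H; elim: r => [|i r IH].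
  by under eq_fun do rewrite big_nil; exact: C1_at_cst.
case Pi : (P i); under eq_fun do rewrite big_cons Pi; last exact: IH.
exact: (C1_atD (H i Pi) IH).
Qed.

Lemma C1_at_prod (I : Type) (r : seq I) (P : pred I) (F : I -> 'rV[R]_4 -> R) x :
  (forall i, P i -> C1_at (F i) x) -> C1_at (fun y => \prod_(i <- r | P i) F i y) x.
Proof.
move=> H; elim: r => [|i r IH].
  by under eq_fun do rewrite big_nil; exact: C1_at_cst.
case Pi : (P i); under eq_fun do rewrite big_cons Pi; last exact: IH.
exact: (C1_atM (H i Pi) IH).
Qed.

Lemma derive_comp1 (h : R -> R) (dh : R) f x v : differentiable f x ->
  is_derive (f x) 1 h dh -> 'D_v (h \o f) x = dh * 'D_v f x.
Proof.
move=> df dhf; have [/derivable1_diffP hd <-] := dhf.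
rewrite deriveE; last exact: differentiable_comp.
rewrite diff_comp//= -[X in 'd h _ X]mulr1 linearZ/= mulrC.
by rewrite -!deriveE.
Qed.

(** Used for the inverse and the square root that occur in the inverse metric
    and the volume density. *)
Lemma C1_at_comp1 (h dh : R -> R) f x : C1_at f x ->
  (\forall t \near f x, is_derive (t : R) 1 h (dh t)) ->
  {for f x, continuous dh} -> C1_at (h \o f) x.
Proof.
move=> cf hd dhc; have [df pf] := cf.
have fc := C1_at_continuous cf.
have hd' : \forall y \near x, is_derive (f y) 1 h (dh (f y)) by exact: fc hd.
split.
  apply: filterS2 df hd' => y dfy [/derivable1_diffP dhy _].
  exact: differentiable_comp.
move=> i; apply: (near_eq_continuous (g := fun y => dh (f y) * partial i f y)).
  by apply: filterS2 df hd' => y dfy dhy; rewrite /partial (derive_comp1 _ dfy dhy).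
have dhf : {for x, continuous (fun y => dh (f y))} by exact: continuous_comp fc dhc.
exact: (continuousM dhf (pf i)).
Qed.

Lemma C1_atV f x : f x != 0 -> C1_at f x -> C1_at (fun y => (f y)^-1) x.
Proof.
move=> fx0 cf; apply: (@C1_at_comp1 (fun t => t^-1) (fun t => - t^-2)) => //.
  have : \forall t \near f x, t != 0.
    exact: (cvgr_neq0 (f:=id) _ cvg_id fx0).
  apply: filterS => t t0.
  have := @is_deriveV R id t 1 1 t0 (is_derive_id _ _).
  by rewrite [_ *: 1]mulr1.
apply: continuousN; apply: continuousV; first by rewrite expf_neq0.
exact: exprn_continuous.
Qed.

Lemma C1_at_sqrt f x : 0 < f x -> C1_at f x -> C1_at (fun y => Num.sqrt (f y)) x.
Proof.
move=> fx0 cf.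
apply: (@C1_at_comp1 Num.sqrt (fun t => (2 * Num.sqrt t)^-1)) => //.
  have : \forall t \near f x, 0 < t.
    exact: (cvgr_gt (f:=id) _ cvg_id _ fx0).
  by apply: filterS => t t0; exact: is_derive1_sqrt.
apply: continuousV; first by rewrite mulf_neq0// gt_eqF// sqrtr_gt0.
by apply: continuousM; [exact: cst_continuous|exact: sqrt_continuous].
Qed.

Lemma C1_at_det n (G : 'rV[R]_4 -> 'M[R]_n) x :
  (forall i j, C1_at (fun y => G y i j) x) -> C1_at (fun y => \det (G y)) x.
Proof.
move=> H; rewrite /determinant; apply: C1_at_sum => s _.
by apply: C1_atM; [exact: C1_at_cst|apply: C1_at_prod].
Qed.

(** Cramer's rule holds only where the determinant is nonzero, which is an open
    condition. *)
Lemma C1_at_invmx (G : 'rV[R]_4 -> 'M[R]_4) x i j : \det (G x) != 0 ->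
  (forall i j, C1_at (fun y => G y i j) x) -> C1_at (fun y => invmx (G y) i j) x.
Proof.
move=> d0 H; have cd := C1_at_det H.
apply: (@C1_at_near_eq (fun y => (\det (G y))^-1 * cofactor (G y) j i)).
  have : \forall y \near x, \det (G y) != 0.
    exact: (cvgr_neq0 (f:=fun y => \det (G y)) _ (C1_at_continuous cd) d0).
  by apply: filterS => y dy; rewrite /invmx unitmxE unitfE dy !mxE.
apply: C1_atM; first exact: C1_atV.
rewrite /cofactor; apply: C1_atM; first exact: C1_at_cst.
by apply: C1_at_det => k l; under eq_fun do rewrite !mxE.
Qed.

Lemma Ck_on_C1_at k U f x : open U -> Ck_on k.+1 U f -> U x -> C1_at f x.
Proof.
move=> oU [fc fd] Ux.
have cp y i : U y -> {for y, continuous (partial i f)}.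
  by have [_] := fd i; case: k {fd} => [|k] [H _]; exact: H.
split; last by move=> i; exact: cp.
have : \forall y \near x, U y by exact: open_nbhs_nbhs.
apply: filterS => y Uy; apply: (differentiable_of_partials oU) => //.
by move=> z i Uz; have [H _] := fd i; exact: H.
Qed.

Lemma Ck_on_partial k U f i : Ck_on k.+1 U f -> Ck_on k U (partial i f).
Proof. by move=> [_ /(_ i)[]]. Qed.

Lemma Ck_on_le k U f : Ck_on k.+1 U f -> Ck_on k U f.
Proof.
elim: k f => [|k IH] f [fc fd]; split=> //.
by move=> i; have [di /IH ci] := fd i.
Qed.

Lemma Ck_on_continuous k U f x : Ck_on k U f -> U x -> {for x, continuous f}.
Proof. by case: k => [|k] [+ _]; apply. Qed.

(** Chain rule in coordinates. *)
Lemma derive_comp_row (T : 'rV[R]_4 -> 'rV[R]_4) f x v :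
  (forall j, differentiable (fun y => T y 0 j) x) -> differentiable f (T x) ->
  'D_v (f \o T) x = \sum_j 'D_v (fun y => T y 0 j) x * partial j f (T x).
Proof.
move=> dT df.
have dTx : differentiable T x.
  rewrite (_ : T = \sum_(j < 4) (fun y => T y 0 j *: e j)).
    by apply: differentiable_sum => j; exact: differentiableZl.
  by apply/funext => y; rewrite fct_sumE -rV4_basisE.
rewrite deriveE; last exact: differentiable_comp.
rewrite diff_comp//= -deriveE// directional_derivativeE//; apply: eq_bigr => j _.
by rewrite -deriveE// derive_mx ?mxE//; exact: diff_derivable.
Qed.

End C1.

(** * Positive definite matrices *)
Section PositiveDefinite.
Variable R : realType.

Definition posdef n (M : 'M[R]_n) :=
  M^T = M /\ forall v : 'rV_n, v != 0 -> 0 < (v *m M *m v^T) 0 0.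

(** Induction on the dimension: with a the top left entry, r the rest of the
    first row and D the lower right block, the Schur complement D - r^T r / a is
    again positive definite. *)
Lemma posdef_cholesky n (M : 'M[R]_n) : posdef M ->
  exists B : 'M[R]_n, M = B *m B^T.
Proof.
elim: n M => [|n IH] M [symM posM].
  by exists 0; apply/matrixP => -[].
rewrite -[n.+1]/(1 + n)%N in M symM posM * .
pose a := M 0 0; pose r : 'rV_n := ursubmx M; pose D : 'M[R]_n := drsubmx M.
have ME : M = block_mx a%:M r r^T D.
  rewrite -{1}[M]submxK; congr block_mx.
    by rewrite [LHS]mx11_scalar !mxE; congr (M _ _)%:M; apply/val_inj.
  by rewrite /r trmx_ursub symM.
have a0 : 0 < a.
  have := posM (row_mx 1%:M 0); rewrite ME tr_row_mx mul_row_block mul_row_col.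
  rewrite !mul0mx !trmx0 !mulmx0 !addr0 trmx1 mulmx1 mul1mx mxE eqxx mulr1n.
  apply; apply/eqP => /matrixP/(_ 0 (lshift n 0)).
  by rewrite row_mxEl !mxE eqxx => /eqP; rewrite oner_eq0.
have [|B' DE] := IH (D - a^-1 *: (r^T *m r)).
  split.
    rewrite raddfB/= linearZ/= trmx_mul trmxK; congr (_ - _).
    by rewrite /D trmx_drsub symM.
  (* (t, w) minimizes the form over the vectors with lower part w; its value
     there is the Schur complement at w. *)
  move=> w w0; pose t := - a^-1 *: (w *m r^T).
  have vn0 : row_mx t w != 0.
    apply: contra w0 => /eqP/(congr1 rsubmx); rewrite row_mxKr => ->.
    by rewrite linear0.
  have := posM _ vn0; rewrite ME tr_row_mx mul_row_block mul_row_col.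
  have -> : t *m a%:M + w *m r^T = 0.
    by rewrite mul_mx_scalar /t scalerA mulrN mulfV ?gt_eqF// scaleN1r addNr.
  rewrite mul0mx add0r /t -scalemxAl mulmxBr mulmxBl mulmxDl.
  rewrite -scalemxAl -!scalemxAr -!scalemxAl scaleNr !mulmxA.
  by rewrite [in X in X -> _]addrC.
pose s := Num.sqrt a.
have s0 : s != 0 by rewrite gt_eqF// sqrtr_gt0.
have ss : s * s = a by rewrite -expr2 sqr_sqrtr// ltW.
exists (block_mx s%:M 0 (s^-1 *: r^T) B').
rewrite tr_block_mx mulmx_block ME !trmx0 !mulmx0 !mul0mx !addr0 -DE.
rewrite tr_scalar_mx -scalar_mxM ss linearZ/= trmxK mul_scalar_mx scalerA.
rewrite mulfV// scale1r mul_mx_scalar scalerA mulfV// scale1r.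
by rewrite -scalemxAl -scalemxAr scalerA -invfM ss addrC subrK.
Qed.

Lemma posdef_unit n (M : 'M[R]_n) : posdef M -> \det M != 0.
Proof.
move=> [_ posM]; apply/det0P => -[v v0 vM].
by have := posM v v0; rewrite vM mul0mx mxE ltxx.
Qed.

Lemma posdef_det n (M : 'M[R]_n) : posdef M -> 0 < \det M.
Proof.
move=> pM; rewrite lt_neqAle eq_sym posdef_unit//=.
by have [B ->] := posdef_cholesky pM; rewrite det_mulmx det_tr -expr2 sqr_ge0.
Qed.

Lemma posdef_invmx n (M : 'M[R]_n) : posdef M -> posdef (invmx M).
Proof.
move=> pM; have uM : M \in unitmx by rewrite unitmxE unitfE posdef_unit.
have [symM posM] := pM; split; first by rewrite trmx_inv symM.
move=> v v0; have := posM (v *m invmx M).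
rewrite trmx_mul trmx_inv symM -!mulmxA (mulmxA M) mulmxV// mul1mx !mulmxA.
by apply; apply: contra v0 => /eqP/(congr1 (mulmx^~ M)); rewrite mulmxKV// mul0mx => ->.
Qed.

Lemma quadratic_formE n (M : 'M[R]_n) (v w : 'rV_n) :
  (v *m M *m w^T) 0 0 = \sum_i \sum_j M i j * v 0 i * w 0 j.
Proof.
rewrite mxE exchange_big; apply: eq_bigr => j _.
rewrite !mxE big_distrl/=; apply: eq_bigr => i _.
by rewrite [v 0 i * _]mulrC.
Qed.

(** Writing M = B B^T turns the contraction into a sum, over the columns of B, of
    values of the quadratic form of H. *)
Lemma posdef_contract_le0 n (M : 'M[R]_n) (H : 'I_n -> 'I_n -> R) : posdef M ->
  (forall v : 'rV_n, \sum_i \sum_j v 0 i * v 0 j * H i j <= 0) ->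
  \sum_i \sum_j M i j * H i j <= 0.
Proof.
move=> /posdef_cholesky[B ->] Hneg.
have -> : \sum_i \sum_j (B *m B^T) i j * H i j =
    \sum_k \sum_i \sum_j (col k B)^T 0 i * (col k B)^T 0 j * H i j.
  rewrite [RHS]exchange_big/=; apply: eq_bigr => i _.
  rewrite [RHS]exchange_big/=; apply: eq_bigr => j _.
  rewrite mxE big_distrl/=; apply: eq_bigr => k _.
  by rewrite !mxE.
by apply: sumr_le0 => k _; exact: Hneg.
Qed.

End PositiveDefinite.

(** * Second derivative test for elliptic operators *)
Section SecondDerivativeTest.
Variable R : realType.
Implicit Types (f g : 'rV[R]_4 -> R) (x v : 'rV[R]_4).

(** The one-variable test along the line through x with direction v. *)
Lemma local_max_second_derivative f x v : C1_at f x ->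
  (forall i, differentiable (partial i f) x) ->
  (\forall y \near x, f y <= f x) ->
  'D_v f x = 0 /\ \sum_i \sum_j v 0 i * v 0 j * partial i (partial j f) x <= 0.
Proof.
move=> cf d2f fmax; have [df pf] := cf.
have lim : (fun t : R => x + t *: v) @ (0 : R) --> x.
  rewrite -[X in _ --> X]addr0 -(scale0r v); apply: cvgD; first exact: cvg_cst.
  by apply: cvgZr_tmp; exact: cvg_id.
have : \forall t \near (0 : R), differentiable f (x + t *: v) /\
                                f (x + t *: v) <= f x.
  have H : \forall y \near x, differentiable f y /\ f y <= f x.
    by apply: filterS2 df fmax.
  exact: (lim _ H).
move=> /near0_ball[d d0 dP].
pose dphi (t : R) := \sum_i v 0 i * partial i f (x + t *: v).
have [|||phi0 phi2] := @second_derivative_at_max R (fun t => f (x + t *: v)) dphi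
  (\sum_i \sum_j v 0 i * v 0 j * partial i (partial j f) x) d d0.
- move=> s /dP[dfs _]; have := is_derive_line (@diff_derivable _ _ _ _ _ v dfs).
  by rewrite directional_derivativeE.
- by move=> s /dP[_]; rewrite scale0r addr0.
- rewrite (_ : dphi = \sum_(i < 4)
      (v 0 i *: (fun t : R => partial i f (x + t *: v)))); last first.
    by apply/funext => t; rewrite fct_sumE.
  have -> : \sum_i \sum_j v 0 i * v 0 j * partial i (partial j f) x =
    \sum_(i < 4) v 0 i *: 'D_v (partial i f) (x + 0 *: v).
    rewrite exchange_big/=; apply: eq_bigr => j _.
    rewrite scale0r addr0 directional_derivativeE// scaler_sumr; apply: eq_bigr => i _.
    by rewrite [v 0 i * _]mulrC -mulrA.
  apply: is_derive_sum => i; apply: is_deriveZ; apply: is_derive_line.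
  by apply: diff_derivable; rewrite scale0r addr0.
split => //; move: phi0; rewrite /dphi scale0r addr0 -directional_derivativeE//.
exact: C1_at_diff.
Qed.

Lemma local_max_elliptic (M : 'M[R]_4) f x : posdef M -> C1_at f x ->
  (forall i, differentiable (partial i f) x) ->
  (\forall y \near x, f y <= f x) ->
  (forall i, partial i f x = 0) /\
  \sum_i \sum_j M i j * partial i (partial j f) x <= 0.
Proof.
move=> pM cf d2f fmax; split.
  by move=> i; have [] := local_max_second_derivative (delta_mx 0 i) cf d2f fmax.
by apply: posdef_contract_le0 => // v;
  have [] := local_max_second_derivative v cf d2f fmax.
Qed.

End SecondDerivativeTest.

(** * Squared Euclidean distance and Gaussian barriers *)
Section Gauss.
Variable R : realType.
Implicit Types (f g : 'rV[R]_4 -> R) (x v p : 'rV[R]_4).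

Lemma continuous_at_sum (T : topologicalType) (I : Type) (r : seq I)
  (F : I -> T -> R) (x : T) :
  (forall i, {for x, continuous (F i)}) ->
  {for x, continuous (fun y => \sum_(i <- r) F i y)}.
Proof.
move=> H; rewrite (_ : (fun y => _) = \sum_(i <- r) F i); last first.
  by apply/funext => y; rewrite fct_sumE.
elim: r => [|i r IH]; first by rewrite big_nil; exact: cst_continuous.
by rewrite big_cons; exact: (continuousD (H i) IH).
Qed.

Lemma is_derive_coord j (c : R) x v :
  is_derive x v (fun y : 'rV[R]_4 => y 0 j - c) (v 0 j).
Proof.
have h : is_derive x v (fun y : 'rV[R]_4 => y 0 j : R) (v 0 j).
  have d : derivable (id : 'rV[R]_4 -> 'rV[R]_4) x v by exact: derivable_id.
  split; first by move/derivable_mxP : d; apply.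
  by have := derive_mx d; rewrite derive_id => /rowP/(_ j); rewrite mxE => ->.
have := is_deriveB h (is_derive_cst c x v).
by rewrite subr0.
Qed.

Lemma C1_at_coord j (c : R) x : C1_at (fun y : 'rV[R]_4 => y 0 j - c) x.
Proof.
split.
  near=> y; apply: differentiableB; first exact: differentiable_coord.
  exact: differentiable_cst.
move=> i; rewrite (_ : partial i _ = fun=> (delta_mx 0 i : 'rV[R]_4) 0 j).
  exact: cst_continuous.
apply/funext => y; rewrite /partial.
by rewrite (@derive_val _ _ _ _ _ _ _ (is_derive_coord j c y _)).
Unshelve. all: by end_near. Qed.

Lemma partial_coord i j (c : R) x :
  partial i (fun y : 'rV[R]_4 => y 0 j - c) x = (i == j)%:R.
Proof.
rewrite /partial (@derive_val _ _ _ _ _ _ _ (is_derive_coord j c x _)).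
by rewrite mxE eqxx eq_sym.
Qed.

Definition sqdist p x : R := \sum_i (x 0 i - p 0 i) * (x 0 i - p 0 i).

Lemma sqdist_ge0 p x : 0 <= sqdist p x.
Proof. by apply: sumr_ge0 => i _; rewrite -expr2 sqr_ge0. Qed.

Lemma C1_at_sqdist p x : C1_at (sqdist p) x.
Proof. by apply: C1_at_sum => i _; apply: C1_atM; exact: C1_at_coord. Qed.

Lemma partial_sqdist p i x : partial i (sqdist p) x = 2 * (x 0 i - p 0 i).
Proof.
rewrite /partial (_ : sqdist p = \sum_(j < 4)
    (fun y : 'rV[R]_4 => (y 0 j - p 0 j) * (y 0 j - p 0 j))).
  rewrite derive_sum => [|j]; last first.
    by apply: diff_derivable; apply/C1_at_diff/C1_atM; exact: C1_at_coord.
  rewrite (bigD1 i)//= big1 ?addr0.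
    rewrite -/(partial i _ x) partialM ?partial_coord ?eqxx.
    - by rewrite mulr1 mul1r mulr_natl mulr2n.
    - exact/C1_at_diff/C1_at_coord.
    - exact/C1_at_diff/C1_at_coord.
  move=> j ji; rewrite -/(partial i _ x) partialM ?partial_coord.
  - by rewrite [i == j]eq_sym (negbTE ji) mulr0 mul0r addr0.
  - exact/C1_at_diff/C1_at_coord.
  - exact/C1_at_diff/C1_at_coord.
by apply/funext => y; rewrite fct_sumE.
Qed.

Definition gauss (al : R) p x : R := expR (- al * sqdist p x).

Lemma C1_at_gauss al p x : C1_at (gauss al p) x.
Proof.
apply: (@C1_at_comp1 _ expR expR (fun y => - al * sqdist p y)).
- by apply: C1_atM; [exact: C1_at_cst|exact: C1_at_sqdist].
- by near=> t; exact: is_derive_expR.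
- exact: continuous_expR.
Unshelve. all: by end_near. Qed.

Lemma partial_gauss al p i :
  partial i (gauss al p) = fun x => (- (2 * al)) * (x 0 i - p 0 i) * gauss al p x.
Proof.
apply/funext => x.
rewrite /partial (@derive_comp1 _ expR (gauss al p x) (fun y => - al * sqdist p y)).
- rewrite -/(partial i _ x) partialM;
    [|exact: differentiable_cst|exact/C1_at_diff/C1_at_sqdist].
  by rewrite partial_sqdist /partial derive_cst; ring.
by apply: C1_at_diff; apply: C1_atM; [exact: C1_at_cst|exact: C1_at_sqdist].
Qed.

Lemma C1_at_partial_gauss al p i x : C1_at (partial i (gauss al p)) x.
Proof.
rewrite partial_gauss; apply: C1_atM; last exact: C1_at_gauss.
by apply: C1_atM; [exact: C1_at_cst|exact: C1_at_coord].
Qed.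

Lemma partial2_gauss al p i j x : partial i (partial j (gauss al p)) x =
  (4 * al ^+ 2 * ((x 0 i - p 0 i) * (x 0 j - p 0 j)) - 2 * al * (i == j)%:R)
   * gauss al p x.
Proof.
rewrite partial_gauss partialM; last exact/C1_at_diff/C1_at_gauss; last first.
  by apply/C1_at_diff/C1_atM; [exact: C1_at_cst|exact: C1_at_coord].
rewrite partialM; last exact/C1_at_diff/C1_at_coord; last exact: differentiable_cst.
have -> : partial i (fun=> - (2 * al)) x = 0 by rewrite /partial derive_cst.
by rewrite partial_coord partial_gauss; ring.
Qed.

(** Apollonius' formula for the median of a triangle. *)
Lemma apollonius p y x : sqdist y x + sqdist p x =
  2 * sqdist (2^-1 *: (y + p)) x + 2^-1 * sqdist y p.
Proof.
rewrite /sqdist -big_split/= !mulr_sumr -big_split/=; apply: eq_bigr => i _.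
by rewrite !mxE; field.
Qed.

Lemma sqdist_midpoint p y : sqdist (2^-1 *: (y + p)) p = 4^-1 * sqdist y p.
Proof.
rewrite /sqdist !mulr_sumr; apply: eq_bigr => i _.
by rewrite !mxE; field.
Qed.

Lemma sqdist_eq0 p x : (sqdist p x == 0) = (x == p).
Proof.
rewrite psumr_eq0; last by move=> i _; rewrite -expr2 sqr_ge0.
apply/idP/eqP => [/allP H|->]; last by apply/allP => i _; rewrite subrr mul0r eqxx.
apply/rowP => i; have := H i; rewrite mem_index_enum => /(_ isT)/=.
by rewrite mulf_eq0 orbb subr_eq0 => /eqP.
Qed.

Lemma norm_le_sqdist p x : `|x - p| ^+ 2 <= sqdist p x.
Proof.
have [->|xp] := eqVneq x p; first by rewrite subrr normr0 expr0n sqdist_ge0.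
rewrite -subr_eq0 in xp.
have [i E] : exists i, `|x - p| = `|(x - p) 0 i|.
  have := mx_norm_neq0 (K := R) (x := x - p); case.
    by rewrite -[mx_norm _]/(`|x - p|) normr_eq0.
  by move=> [j i] /= E; exists i; rewrite ord1 in E.
rewrite E real_normK ?num_real// /sqdist (bigD1 i)//= !mxE -expr2 lerDl.
by apply: sumr_ge0 => j _; rewrite -expr2 sqr_ge0.
Qed.

Lemma sqdist_le_norm p x : sqdist p x <= 4 * `|x - p| ^+ 2.
Proof.
have -> : 4 * `|x - p| ^+ 2 = \sum_(i < 4) `|x - p| ^+ 2.
  by rewrite sumr_const card_ord mulr_natl.
apply: ler_sum => i _; rewrite -expr2 -real_normK ?num_real//.
rewrite lerXn2r ?nnegrE//.
by have := rV_norm_coord (x - p) i; rewrite !mxE.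
Qed.

End Gauss.

(** * The strong maximum principle *)
Section Hopf.
Variable R : realType.
Variables (U : set 'rV[R]_4) (M : 'rV[R]_4 -> 'M[R]_4)
  (b : 'I_4 -> 'rV[R]_4 -> R) (q z : 'rV[R]_4 -> R).
Hypothesis oU : open U.
Hypothesis posM : forall x, U x -> posdef (M x).
Hypothesis contM : forall x i j, U x -> {for x, continuous (fun y => M y i j)}.
Hypothesis contb : forall x i, U x -> {for x, continuous (b i)}.
Hypothesis contq : forall x, U x -> {for x, continuous q}.
Hypothesis C1z : forall x, U x -> C1_at z x.
Hypothesis C2z : forall x i, U x -> C1_at (partial i z) x.
Hypothesis z_le0 : forall x, U x -> z x <= 0.
Hypothesis z_eq : forall x, U x ->
  \sum_i \sum_j M x i j * partial i (partial j z) x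
  + \sum_i b i x * partial i z x = q x * z x.

(** On exp (- al |x - p|^2) the operator acts as multiplication by
    4 al^2 <M (x - p), x - p> - O(al).  By ellipticity the quadratic term is
    bounded below near x0, so a large al makes the Gaussian a strict
    subsolution, even with |q| added as zero-order coefficient. *)
Lemma hopf_barrier_constants (x0 p : 'rV[R]_4) : U x0 -> x0 != p ->
  exists al r : R, [/\ 0 < al, 0 < r,
    forall x, `|x0 - x| <= r -> U x &
    forall x, `|x0 - x| <= r ->
      `|q x| * gauss al p x <
      \sum_i \sum_j M x i j * partial i (partial j (gauss al p)) x
      + \sum_i b i x * partial i (gauss al p) x].
Proof.
move=> Ux0 x0p.
pose Qf x := \sum_i \sum_j M x i j * (x 0 i - p 0 i) * (x 0 j - p 0 j).
pose B1 x := 2 * (\sum_i M x i i + \sum_i b i x * (x 0 i - p 0 i)).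
have cc i : {for x0, continuous (fun y : 'rV[R]_4 => y 0 i - p 0 i)}.
  exact/C1_at_continuous/C1_at_coord.
have cQ : {for x0, continuous Qf}.
  apply: continuous_at_sum => i; apply: continuous_at_sum => j.
  by apply: continuousM (cc j); apply: continuousM (cc i); exact: contM.
have cB : {for x0, continuous B1}.
  apply: continuousM; first exact: cst_continuous.
  apply: (@continuousD _ _ _ (fun y => \sum_i M y i i)
            (fun y => \sum_i b i y * (y 0 i - p 0 i))).
    by apply: continuous_at_sum => i; exact: contM.
  by apply: continuous_at_sum => i; apply: continuousM (cc i); exact: contb.
have Q0 : 0 < Qf x0.
  have := (posM Ux0).2 (x0 - p); rewrite subr_eq0 => /(_ x0p).
  rewrite quadratic_formE; congr (_ < _).
  by apply: eq_bigr => i _; apply: eq_bigr => j _; rewrite !mxE.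
pose k := Qf x0 / 2.
have k0 : 0 < k by rewrite divr_gt0.
have kQ : k < Qf x0 by rewrite /k ltr_pdivrMr// ltr_pMr// ltr1n.
pose B := `|B1 x0| + `|q x0| + 1.
have B0 : 0 < B by rewrite /B ltr_wpDl// addr_ge0.
have n1 : \forall x \near x0, U x by exact: open_nbhs_nbhs.
have n2 : \forall x \near x0, k < Qf x by exact: (cvgr_gt (f := Qf) _ cQ _ kQ).
have n3 : \forall x \near x0, B1 x < B.
  apply: (cvgr_lt (f := B1) _ cB).
  by have := ler_norm (B1 x0); have := normr_ge0 (q x0); rewrite /B; lra.
have n4 : \forall x \near x0, `|q x| < B.
  apply: (cvgr_lt (f := fun x => `|q x|) _ (cvg_norm (contq Ux0))).
  by have := normr_ge0 (B1 x0); rewrite /B; lra.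
have : \forall x \near x0, (U x /\ k < Qf x) /\ (B1 x < B /\ `|q x| < B).
  exact: filterI (filterI n1 n2) (filterI n3 n4).
move=> /nbhs_ballP[d /= d0 dP].
(* al >= 1 and al k >= B give 4 al^2 k >= 4 al B > al B + B, which absorbs
   the first- and zero-order terms. *)
pose al := 1 + B / k.
have al1 : 1 <= al by rewrite /al lerDl divr_ge0// ltW.
have al0 : 0 < al by exact: lt_le_trans al1.
have kal : B <= al * k by rewrite /al mulrDl divfK ?gt_eqF// lerDr mul1r ltW.
exists al, (d / 2); split => //.
- by rewrite divr_gt0.
- move=> x xd; have [] // := dP x; last by case.
  rewrite -ball_normE/=; apply: le_lt_trans xd _.
  by rewrite ltr_pdivrMr// ltr_pMr// ltr1n.
move=> x xd; have [|[Ux Qx] [Bx qx]] := dP x.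
  rewrite -ball_normE/=; apply: le_lt_trans xd _.
  by rewrite ltr_pdivrMr// ltr_pMr// ltr1n.
have -> : \sum_i \sum_j M x i j * partial i (partial j (gauss al p)) x
      + \sum_i b i x * partial i (gauss al p) x =
   (4 * al ^+ 2 * Qf x - al * B1 x) * gauss al p x.
  have -> : \sum_i \sum_j M x i j * partial i (partial j (gauss al p)) x =
    (4 * al ^+ 2 * Qf x - 2 * al * \sum_i M x i i) * gauss al p x.
    rewrite mulrBl !mulr_sumr !mulr_suml -sumrB; apply: eq_bigr => i _.
    have -> : 2 * al * M x i i * gauss al p x =
        \sum_j M x i j * (2 * al * (i == j)%:R) * gauss al p x.
      rewrite (bigD1 i)//= big1 ?addr0 ?eqxx ?mulr1; last first.
        by move=> j ji; rewrite eq_sym (negbTE ji) !(mulr0, mul0r).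
      by rewrite [M x i i * _]mulrC.
    rewrite mulr_sumr mulr_suml -sumrB; apply: eq_bigr => j _.
    by rewrite partial2_gauss; ring.
  have -> : \sum_i b i x * partial i (gauss al p) x =
    - (2 * al) * (\sum_i b i x * (x 0 i - p 0 i)) * gauss al p x.
    rewrite mulr_sumr mulr_suml; apply: eq_bigr => i _.
    by rewrite partial_gauss; ring.
  by rewrite /B1; ring.
rewrite ltr_pM2r ?expR_gt0//; apply: (lt_trans qx).
have h1 : al * B1 x < al * B by rewrite ltr_pM2l.
have h2 : 4 * al ^+ 2 * k < 4 * al ^+ 2 * Qf x.
  by rewrite ltr_pM2l// mulr_gt0// exprn_gt0.
have h3 : 4 * al * B <= 4 * al * (al * k) by rewrite ler_pM2l// mulr_gt0.
have h4 : B <= al * B by rewrite ler_peMl// ltW.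
have h5 : 4 * al * (al * k) = 4 * al ^+ 2 * k by ring.
lra.
Qed.

(** The arithmetic that ends [hopf_touching]: S1 and S2 stand for the second-
    and first-order parts of the operator on z plus eps times the barrier, and
    T for the operator on the barrier. *)
Lemma barrier_contradiction (eps S1 S2 S T g : R) : 0 < eps -> S1 <= 0 ->
  S2 = 0 -> S1 + S2 = S + eps * T -> g < T -> - (eps * g) <= S -> False.
Proof.
move=> eps0 S10 -> E; rewrite -(ltr_pM2l eps0) => gT gS; lra.
Qed.

(** The zero set of z cannot touch from outside a ball where z < 0.  With p the
    midpoint of y and x0, the ball of centre p through x0 meets the complement
    of the given ball at x0 only.  A small multiple of the Gaussian centred at
    p, normalized to vanish at x0, is added to z: the sum zeta is 0 at x0 and
    negative on the boundary of a small cube around x0, so it has an interior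
    maximum x1 in that cube, with zeta x1 >= 0.  There the operator is
    nonpositive on zeta, whereas the equation for z and
    [hopf_barrier_constants] make it positive. *)
Lemma hopf_touching (x0 y : 'rV[R]_4) : U x0 -> x0 != y -> z x0 = 0 ->
  (forall x, U x -> sqdist y x < sqdist y x0 -> z x < 0) -> False.
Proof.
move=> Ux0 x0y zx0 zneg.
pose p := 2^-1 *: (y + x0).
have d0 : 0 < sqdist y x0.
  by rewrite lt_neqAle sqdist_ge0 andbT eq_sym sqdist_eq0.
have x0p : x0 != p.
  by rewrite -sqdist_eq0 /p sqdist_midpoint mulf_neq0// gt_eqF.
have [al [r [al0 r0 rU rP]]] := hopf_barrier_constants Ux0 x0p.
pose c0 := gauss al p x0.
pose h x := gauss al p x - c0.
have ap x : sqdist x0 x = 2 * sqdist p x - 2^-1 * sqdist y x0 +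
    (sqdist y x0 - sqdist y x).
  by have := apollonius x0 y x; rewrite -/p; lra.
have px0 : sqdist p x0 = 4^-1 * sqdist y x0 by exact: sqdist_midpoint.
have cz x : U x -> {for x, continuous z} by move=> Ux; exact/C1_at_continuous/C1z.
have cg x : {for x, continuous (gauss al p)}.
  exact/C1_at_continuous/C1_at_gauss.
pose Q := [set x | `|x0 - x| <= r].
have kQ : compact Q by exact: compact_norm_ball.
have cQ : closed Q by apply: compact_closed kQ; exact: norm_hausdorff.
(* The part of the boundary of the cube where the barrier is not negative: it
   is compact and z is negative on it. *)
pose S := Q `&` [set x | `|x0 - x| = r] `&` [set x | c0 <= gauss al p x].
have cN : continuous (fun x : 'rV[R]_4 => `|x0 - x|).
  move=> x; apply: (@cvg_norm _ _ _ (nbhs x) _ (fun y => x0 - y) (x0 - x)).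
  by apply: cvgB; [exact: cvg_cst|exact: cvg_id].
have kS : compact S.
  apply: (@subclosed_compact _ S Q) => //; last by move=> x [[]].
  apply: closedI; first apply: closedI => //.
    apply: (@preimage_closed _ _ (fun x : 'rV[R]_4 => `|x0 - x|) [set t : R | t = r]).
      by move=> x _; exact: cN.
    exact: closed_eq.
  apply: (@preimage_closed _ _ (gauss al p) [set t | c0 <= t]).
    by move=> x _; exact: cg.
  exact: closed_ge.
have zS x : S x -> z x < 0.
  move=> [[Qx xr] cx]; apply: zneg; first exact: rU.
  have : sqdist p x <= sqdist p x0.
    move: cx; rewrite /= /c0 /gauss ler_expR !mulNr lerN2 ler_pM2l//.
  have : 0 < sqdist x0 x.
    rewrite lt_neqAle sqdist_ge0 andbT eq_sym sqdist_eq0.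
    by apply/eqP => xx0; move: r0; rewrite -xr xx0 subrr normr0 ltxx.
  rewrite ap px0; lra.
have cQz : {within Q, continuous z}.
  by apply: continuous_in_subspaceT => x /set_mem/rU; exact: cz.
have [del del0 delS] : exists2 del, 0 < del & forall x, S x -> z x <= - del.
  have [S0|/set0P S0] := eqVneq S set0; first by exists 1 => // x; rewrite S0.
  have [|x1 /set_mem Sx1 x1max] := compact_EVT_max S0 kS (f := z).
    by apply: continuous_subspaceW cQz => x [[]].
  exists (- z x1); first by rewrite oppr_gt0 zS.
  by move=> x Sx; rewrite opprK; apply: x1max; rewrite inE.
pose eps := del / 2.
have eps0 : 0 < eps by rewrite divr_gt0.
pose zeta x := z x + eps * h x.
have [||x1 /set_mem Qx1 x1max] := compact_EVT_max _ kQ (f := zeta).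
- by exists x0; rewrite /Q/= subrr normr0 ltW.
- apply: continuous_in_subspaceT => x /set_mem/rU Ux.
  apply: (@continuousD _ _ _ z (fun x => eps * h x)); first exact: cz.
  apply: continuousM; first exact: cst_continuous.
  by apply: continuousB; [exact: cg|exact: cst_continuous].
have Ux1 := rU _ Qx1.
have zeta0 : 0 <= zeta x1.
  have -> : 0 = zeta x0 by rewrite /zeta zx0 /h /c0 subrr mulr0 addr0.
  by apply: x1max; rewrite inE /Q/= subrr normr0 ltW.
have g1 x : gauss al p x <= 1.
  by rewrite /gauss -expR0 ler_expR mulNr oppr_le0 mulr_ge0 ?sqdist_ge0// ltW.
have c00 : 0 < c0 by exact: expR_gt0.
have x1r : `|x0 - x1| < r.
  rewrite lt_neqAle Qx1 andbT; apply/eqP => x1r.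
  move: zeta0; apply/negP; rewrite -ltNge /zeta.
  have [cx1|cx1] := leP c0 (gauss al p x1).
    have := delS x1 (conj (conj Qx1 x1r) cx1).
    have : eps * h x1 <= eps * 1 by rewrite ler_pM2l// /h; have := g1 x1; lra.
    by rewrite mulr1 /eps; lra.
  rewrite -[ltRHS]addr0 ler_ltD ?z_le0// pmulr_rlt0// /h subr_lt0//.
have zmax : \forall x \near x1, zeta x <= zeta x1.
  have : \forall x \near x1, `|x0 - x| < r.
    exact: (cvgr_lt (f := fun x => `|x0 - x|) _ (cN x1) _ x1r).
  by apply: filterS => x xr; apply: x1max; rewrite inE /Q/= ltW.
have C1h x : C1_at h x by apply: C1_atD; [exact: C1_at_gauss|exact: C1_at_cst].
have ph i : partial i h = partial i (gauss al p).
  apply/funext => x; rewrite /partial deriveB.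
  - by rewrite derive_cst subr0.
  - by apply: diff_derivable; exact/C1_at_diff/C1_at_gauss.
  - exact: derivable_cst.
have C1g i x : C1_at (partial i h) x by rewrite ph; exact: C1_at_partial_gauss.
have pz i x : U x -> partial i zeta x = partial i z x + eps * partial i h x.
  move=> Ux; apply: (@partial_lincomb _ i eps z h); first exact/C1_at_diff/C1z.
  exact/C1_at_diff.
have ppz i j x : U x -> partial i (partial j zeta) x =
    partial i (partial j z) x + eps * partial i (partial j h) x.
  move=> Ux; apply: (@partial2_lincomb _ i j eps z h) => //; first exact: C1z.
  exact: C2z.
have zle := z_le0 Ux1.
(* z x1 is small, so the zero-order term is absorbed by the barrier. *)
have zge : - z x1 <= eps * gauss al p x1.
  have : eps * h x1 <= eps * gauss al p x1.
    by rewrite ler_pM2l// /h; lra.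
  by move: zeta0; rewrite /zeta; lra.
have qz : - (eps * (`|q x1| * gauss al p x1)) <= q x1 * z x1.
  rewrite mulrCA lerNl (le_trans (ler_norm _))// normrN normrM ler_wpM2l//.
  by rewrite ler0_norm.
have [||z1 z2] := local_max_elliptic (f := zeta) (posM Ux1) _ _ zmax.
- by apply: (@C1_at_lincomb _ eps z h) => //; exact: C1z.
- move=> i; apply: C1_at_diff; apply: (@C1_at_partial_lincomb _ i eps z h) => //.
    exact: C1z.
  exact: C2z.
have E : \sum_i \sum_j M x1 i j * partial i (partial j zeta) x1 +
    \sum_i b i x1 * partial i zeta x1 =
    q x1 * z x1 + eps *
    (\sum_i \sum_j M x1 i j * partial i (partial j (gauss al p)) x1
      + \sum_i b i x1 * partial i (gauss al p) x1).
  rewrite -z_eq// mulrDr addrACA; congr (_ + _).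
    rewrite mulr_sumr -big_split/=; apply: eq_bigr => i _.
    rewrite mulr_sumr -big_split/=; apply: eq_bigr => j _.
    by rewrite (ppz _ _ _ Ux1) ph mulrDr [M x1 i j * (eps * _)]mulrCA.
  rewrite mulr_sumr -big_split/=; apply: eq_bigr => i _.
  by rewrite (pz _ _ Ux1) ph mulrDr [b i x1 * (eps * _)]mulrCA.
have b0 : \sum_i b i x1 * partial i zeta x1 = 0.
  by apply: big1 => i _; rewrite z1 mulr0.
have gP : `|q x1| * gauss al p x1 < _ := rP x1 Qx1.
exact: (barrier_contradiction eps0 z2 b0 E gP qz).
Qed.

(** If z were negative at a point y close to xs, the zero of z nearest to y
    would be a zero touched by a ball of negativity centred at y, which
    [hopf_touching] forbids. *)
Lemma strong_maximum (xs : 'rV[R]_4) : U xs -> z xs = 0 ->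
  \forall x \near xs, z x = 0.
Proof.
move=> Uxs zxs.
have : \forall x \near xs, U x by exact: open_nbhs_nbhs.
move=> /nbhs_ballP[d /= d0 dU].
(* The Euclidean distance in R^4 is at most twice the sup distance: if y is at
   sup distance less than r from xs, every point at least as close to y as xs
   is within 3 r of xs, hence in U. *)
pose r := d / 4.
have r0 : 0 < r by rewrite divr_gt0.
apply/nbhs_ballP; exists r => //= y; rewrite -ball_normE/= => yr.
apply/eqP; apply: contraT => zy0.
have ballU x : `|xs - x| <= 3 * r -> U x.
  move=> xr; apply: dU; rewrite -ball_normE/=; apply: le_lt_trans xr _.
  by rewrite /r; lra.
have Uy : U y by apply: ballU; apply: (le_trans (ltW yr)); lra.
have zy : z y < 0 by rewrite lt_neqAle zy0 z_le0.
pose K := [set x | `|xs - x| <= 3 * r /\ z x = 0].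
have kK : compact K.
  apply: (@subclosed_compact _ K [set x | `|xs - x| <= 3 * r]).
  - move=> x clx.
    have xr : `|xs - x| <= 3 * r.
      have cB : closed [set y | `|xs - y| <= 3 * r].
        by apply: compact_closed; [exact: norm_hausdorff|exact: compact_norm_ball].
      by apply: cB; apply: closure_subset clx => t [].
    split => //; apply/eqP; apply: contraT => zx.
    have cz : {for x, continuous z} by apply/C1_at_continuous/C1z/ballU.
    have [t [[_ zt] /= zt0]] := clx _ (cvgr_neq0 (f := z) _ cz zx).
    by rewrite zt eqxx in zt0.
  - exact: compact_norm_ball.
  - by move=> x [].
have [||x0 /set_mem[x0r zx0] x0min] := compact_EVT_min _ kK (f := sqdist y).
- by exists xs; split => //; rewrite subrr normr0 mulr_ge0// ltW.
- by apply: continuous_subspaceT => x; exact/C1_at_continuous/C1_at_sqdist.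
have Kxs : K xs by split => //; rewrite subrr normr0 mulr_ge0// ltW.
exfalso; apply: (@hopf_touching x0 y) => //.
- exact: ballU.
- by apply/eqP => x0y; move: zy; rewrite -x0y zx0 ltxx.
move=> x Ux xd; rewrite lt_neqAle z_le0// andbT; apply/eqP => zx.
move: (xd); apply/negP; rewrite -leNgt; apply: (x0min); apply/mem_set; split => //.
rewrite leNgt; apply/negP => xr.
have far : 2 * r < `|x - y|.
  have := ler_distD y xs x; rewrite (distrC y x); lra.
have : sqdist y x <= 4 * `|xs - y| ^+ 2.
  apply: (@le_trans _ _ (sqdist y xs)); last exact: sqdist_le_norm.
  apply: (@le_trans _ _ (sqdist y x0)); first exact: ltW.
  by apply: (x0min); apply/mem_set.
apply/negP; rewrite -ltNge.
apply: lt_le_trans (norm_le_sqdist y x).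
have E : (2 * r) ^+ 2 = 4 * r ^+ 2 by ring.
have : (2 * r) ^+ 2 < `|x - y| ^+ 2.
  by rewrite ltr_pXn2r ?nnegrE ?normr_ge0 ?(mulr_ge0 _ (ltW r0)).
have : `|xs - y| ^+ 2 < r ^+ 2 by rewrite ltr_pXn2r ?nnegrE ?normr_ge0 ?(ltW r0).
by rewrite E; lra.
Qed.

End Hopf.

(** * The divergence form operator in coordinates *)
Section LocalOperator.
Variable R : realType.
Variables (U : set 'rV[R]_4) (G : 'rV[R]_4 -> 'M[R]_4) (al : 'rV[R]_4 -> R).
Hypothesis posG : forall x, U x -> posdef (G x).
Hypothesis C1G : forall x i j, U x -> C1_at (fun y => G y i j) x.
Hypothesis C1al : forall x, U x -> C1_at al x.
Hypothesis al_gt0 : forall x, U x -> 0 < al x.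

(** [principal_part] and [drift] are the coefficients obtained when the outer
    derivative of (det g)^(-1/2) d_i ((det g)^(1/2) a g^ij d_j v) is carried
    out; [flux_coef] is the coefficient inside it. *)
Definition principal_part x : 'M[R]_4 := al x *: invmx (G x).

Definition flux_coef i j x : R := volume_density G x * (al x * metric_inv G x i j).

Definition drift j x : R :=
  (volume_density G x)^-1 * \sum_i partial i (flux_coef i j) x.

Lemma C1_at_metric_inv x i j : U x -> C1_at (fun y => metric_inv G y i j) x.
Proof.
move=> Ux; apply: C1_at_invmx; first exact: posdef_unit (posG Ux).
by move=> k l; exact: C1G.
Qed.

Lemma C1_at_volume_density x : U x -> C1_at (volume_density G) x.
Proof.
move=> Ux; apply: C1_at_sqrt; first exact: posdef_det (posG Ux).
by apply: C1_at_det => k l; exact: C1G.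
Qed.

Lemma volume_density_gt0 x : U x -> 0 < volume_density G x.
Proof. by move=> Ux; rewrite sqrtr_gt0; exact: posdef_det (posG Ux). Qed.

Lemma C1_at_flux_coef i j x : U x -> C1_at (flux_coef i j) x.
Proof.
move=> Ux; apply: C1_atM; first exact: C1_at_volume_density.
by apply: C1_atM; [exact: C1al|exact: C1_at_metric_inv].
Qed.

Lemma posdef_principal_part x : U x -> posdef (principal_part x).
Proof.
move=> Ux; have [symI posI] := posdef_invmx (posG Ux).
split; first by rewrite /principal_part linearZ/= symI.
move=> v v0; rewrite -scalemxAr -scalemxAl mxE mulr_gt0//; first exact: al_gt0.
exact: posI.
Qed.

Lemma continuous_principal_part x i j : U x ->
  {for x, continuous (fun y => principal_part y i j)}.
Proof.
move=> Ux; rewrite (_ : (fun y => _) = fun y => al y * metric_inv G y i j).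
  apply/C1_at_continuous/C1_atM; [exact: C1al|exact: C1_at_metric_inv].
by apply/funext => y; rewrite /principal_part mxE.
Qed.

Lemma continuous_drift x j : U x -> {for x, continuous (drift j)}.
Proof.
move=> Ux; apply: (@continuousM _ _ (fun y => (volume_density G y)^-1)
  (fun y => \sum_i partial i (flux_coef i j) y)).
  apply: continuousV; first by rewrite gt_eqF// volume_density_gt0.
  exact/C1_at_continuous/C1_at_volume_density.
by apply: continuous_at_sum => i; have [_] := C1_at_flux_coef i j Ux.
Qed.

Definition nondiv_operator (v : 'rV[R]_4 -> R) x : R :=
  \sum_i \sum_j principal_part x i j * partial i (partial j v) x
  + \sum_j drift j x * partial j v x.

Lemma divergence_locE v x : U x -> (forall i, C1_at (partial i v) x) ->
  divergence_loc G (fun y => al y *: gradient_loc G v y) x = nondiv_operator v x.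
Proof.
move=> Ux C2v; rewrite /divergence_loc.
have -> : \sum_i partial i (fun y => volume_density G y *
    (al y *: gradient_loc G v y) 0 i) x =
  \sum_i \sum_j (flux_coef i j x * partial i (partial j v) x +
                 partial i (flux_coef i j) x * partial j v x).
  apply: eq_bigr => i _.
  rewrite (_ : (fun y => _) =
     \sum_(j < 4) (fun y => flux_coef i j y * partial j v y)); last first.
    apply/funext => y; rewrite fct_sumE !mxE mulr_sumr mulr_sumr.
    by apply: eq_bigr => j _; rewrite /flux_coef !mulrA.
  rewrite [LHS]derive_sum; last first.
    move=> j; apply: diff_derivable; apply: C1_at_diff; apply: C1_atM => //.
    exact: C1_at_flux_coef.
  apply: eq_bigr => j _; apply: (@partialM _ i (flux_coef i j) (partial j v)).
    exact/C1_at_diff/C1_at_flux_coef.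
  exact/C1_at_diff/C2v.
under eq_bigr do rewrite big_split/=.
rewrite big_split/= mulrDr; congr (_ + _).
  rewrite mulr_sumr; apply: eq_bigr => i _; rewrite mulr_sumr.
  apply: eq_bigr => j _; rewrite /flux_coef -mulrA mulKf.
    by rewrite /principal_part mxE.
  by rewrite gt_eqF// volume_density_gt0.
rewrite exchange_big/= mulr_sumr; apply: eq_bigr => j _.
by rewrite /drift -mulr_suml mulrA.
Qed.

End LocalOperator.

(** * Borel sets of R^4 as a product of lines *)
Lemma open_preimage_at (T T' : topologicalType) (U : set T) (V : set T')
  (f : T -> T') : open U -> (forall x, U x -> {for x, continuous f}) ->
  open V -> open (U `&` f @^-1` V).
Proof.
move=> oU cf oV; rewrite openE => x [Ux Vx]; rewrite /interior.
apply: filterI; first exact: open_nbhs_nbhs.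
by apply: (cf x Ux); exact: open_nbhs_nbhs.
Qed.

Section BorelR4.
Variable R : realType.
Local Notation RM := (measurableTypeR R).
Local Notation RM4 := (RM * RM * RM * RM)%type.

Lemma measurable_vec4_coord (i : 'I_4) :
  measurable_fun [set: RM4] (fun t : RM4 => vec4 t 0 i : RM).
Proof.
case: i => -[|[|[|[|//]]]] h; under eq_fun do rewrite mxE/=.
- apply: (measurableT_comp (f := fst)); first exact: measurable_fst.
  apply: (measurableT_comp (f := fst)); first exact: measurable_fst.
  exact: measurable_fst.
- apply: (measurableT_comp (f := snd)); first exact: measurable_snd.
  apply: (measurableT_comp (f := fst)); first exact: measurable_fst.
  exact: measurable_fst.
- apply: (measurableT_comp (f := snd)); first exact: measurable_snd.
  exact: measurable_fst.
- exact: measurable_snd.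
Qed.

Lemma measurable_vec4_ball (x : 'rV[R]_4) (r : R) : 0 < r ->
  measurable [set t : RM4 | ball x r (vec4 t)].
Proof.
move=> r0.
have -> : [set t : RM4 | ball x r (vec4 t)] =
    \bigcap_(i in [set: 'I_4]) [set t : RM4 | ball (x 0 i) r (vec4 t 0 i)].
  apply/seteqP; split => t /=.
    move=> xt i _ /=; move: xt; rewrite -!ball_normE/= => xt.
    by apply: le_lt_trans xt; have := rV_norm_coord (x - vec4 t) i; rewrite !mxE.
  move=> xt; rewrite -ball_normE/=; apply: rV_norm_lt => // i.
  by have := xt i I; rewrite /= -ball_normE/= !mxE.
apply: fin_bigcap_measurable; first exact: finite_finset.
move=> i _.
have := measurable_vec4_coord i; move=> /(_ measurableT (ball (x 0 i) r)).
rewrite setTI; apply; apply: open_measurable; exact: ball_open.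
Qed.

(** Every open set is the union of the cubes with rational centre and radius
    1 / (n + 1) that it contains. *)
Lemma measurable_vec4_open (U : set 'rV[R]_4) : open U ->
  measurable [set t : RM4 | U (vec4 t)].
Proof.
move=> oU.
pose c (q : 'rV[rat]_4 * nat) : 'rV[R]_4 := \row_i ratr (q.1 0 i).
pose F (q : 'rV[rat]_4 * nat) : set RM4 :=
  if `[< ball (c q) q.2.+1%:R^-1 `<=` U >]
  then [set t | ball (c q) q.2.+1%:R^-1 (vec4 t)] else set0.
have -> : [set t : RM4 | U (vec4 t)] = \bigcup_q F q.
  apply/seteqP; split => t /=; last first.
    by move=> [q _]; rewrite /F; case: ifPn => // /asboolP qU /= /qU.
  move=> Ut; have : \forall y \near vec4 t, U y by exact: open_nbhs_nbhs.
  move=> /nbhs_ballP[d /= d0 dU].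
  have [n nd] : exists n : nat, n.+1%:R^-1 < d / 2.
    have d20 : 0 < d / 2 by rewrite divr_gt0.
    have := near_infty_natSinv_lt (PosNum d20).
    by move=> [n _ /(_ n (leqnn _)) /= H]; exists n.
  have n0 : 0 < n.+1%:R^-1 :> R by rewrite invr_gt0.
  have /choice[f fP] : forall i, exists q : rat, `|ratr q - vec4 t 0 i| < n.+1%:R^-1.
    move=> i.
    have [|q] := @rat_in_itvoo R (vec4 t 0 i - n.+1%:R^-1) (vec4 t 0 i + n.+1%:R^-1).
      by rewrite ltrD2l gt0_cp.
    by rewrite in_itv/= => qi; exists q; rewrite ltr_distl.
  pose q : 'rV[rat]_4 * nat := (\row_i f i, n).
  have cq : `|c q - vec4 t| < n.+1%:R^-1.
    apply: rV_norm_lt => // i; have := fP i.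
    by rewrite /c /q /= 3![in X in _ -> X]mxE [in X in _ -> X]mxE.
  exists q => //; rewrite /F asboolT; first by rewrite -ball_normE/=.
  move=> y; rewrite -ball_normE/= => yq; apply: dU; rewrite -ball_normE/=.
  apply: le_lt_trans (ler_distD (c q) _ _) _.
  by rewrite (distrC (vec4 t)) [d]splitr ltrD// (lt_trans _ nd).
apply: countable_bigcupT_measurable; first exact: countableP.
move=> q; rewrite /F; case: ifPn => // _; apply: measurable_vec4_ball.
by rewrite invr_gt0.
Qed.

Lemma measurable_vec4_comp (U : set 'rV[R]_4) (f : 'rV[R]_4 -> R) : open U ->
  (forall x, U x -> {for x, continuous f}) ->
  measurable_fun [set t : RM4 | U (vec4 t)] (fun t : RM4 => f (vec4 t)).
Proof.
move=> oU cf mU; apply: (measurability _ (RGenOpens.measurableE R)) => //.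
move=> _ [_ [a [b ->] <-]].
rewrite (_ : _ `&` _ = [set t : RM4 | (U `&` f @^-1` `]a, b[) (vec4 t)]).
  apply: measurable_vec4_open; apply: open_preimage_at => //.
by apply/seteqP; split => t /=.
Qed.

End BorelR4.

(** * Integrals of functions supported in a box *)
Section CompactlySupportedIntegrals.
Variable R : realType.
Local Open Scope ereal_scope.

(** The fundamental theorem of calculus on [-c, c]. *)
Lemma integral_derivative_eq0 (phi dphi : R -> R) (c : R) : (0 < c)%R ->
  (forall s : R, is_derive s 1%R phi (dphi s)) -> continuous dphi ->
  (forall s, (c <= `|s|)%R -> phi s = 0%R) ->
  (forall s, (c < `|s|)%R -> dphi s = 0%R) ->
  \int[@lebesgue_measure R]_s (dphi s)%:E = 0.
Proof.
move=> c0 dphiE cdphi phi0 dphi0.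
have cphi : continuous phi.
  by move=> s; apply: differentiable_continuous; apply/derivable1_diffP; case: (dphiE s).
have -> : \int[@lebesgue_measure R]_s (dphi s)%:E =
    \int[@lebesgue_measure R]_(s in `[(- c)%R, c]) (dphi s)%:E.
  rewrite [RHS]integral_mkcond; apply: eq_integral => s _.
  rewrite patchE; case: ifPn => // /negP sc; rewrite dphi0//.
  by rewrite ltNge ler_norml; apply/negP => h; apply: sc; rewrite inE/= in_itv/=.
rewrite (@continuous_FTC2 R dphi phi).
- by rewrite !phi0 ?normrN ?ger0_norm ?(ltW c0)// -EFinB subrr.
- by rewrite gt0_cp.
- exact: continuous_subspaceT.
- split.
  + by move=> s _; case: (dphiE s).
  + by apply: cvg_at_right_filter; exact: cphi.
  + by apply: cvg_at_left_filter; exact: cphi.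
- by move=> s _; rewrite derive1E; case: (dphiE s).
Qed.

Section Bounded.
Context d (T : measurableType d).
Implicit Types (B : set T) (f : T -> R).

(** This class is inherited by slices and implies integrability when B has
    finite measure, so that Fubini's theorem can be applied once for each
    coordinate. *)
Definition bounded_supported B f := [/\ measurable_fun setT f,
  exists k : R, forall t, (`|f t| <= k)%R & forall t, ~ B t -> f t = 0%R].

Lemma bounded_supported_integrable (m : {measure set T -> \bar R}) B f :
  measurable B -> m B < +oo -> bounded_supported B f -> m.-integrable setT (EFin \o f).
Proof.
move=> mB Bfin [mf [k fk] f0].
rewrite (_ : EFin \o f = (EFin \o f) \_ B); last first.
  apply/funext => t; rewrite patchE; case: ifPn => // /negP tB.
  by rewrite /= f0// => Bt; apply: tB; rewrite inE.
rewrite -integrable_mkcond//; apply: measurable_bounded_integrable => //.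
  exact: measurable_funTS.
exists k; split; first exact: num_real.
by move=> x kx t Bt /=; rewrite (le_trans (fk t))// ltW.
Qed.

End Bounded.

Section SigmaFiniteProduct.
Context d1 d2 (T1 : measurableType d1) (T2 : measurableType d2).
Variables (m1 : {sigma_finite_measure set T1 -> \bar R})
  (m2 : {sigma_finite_measure set T2 -> \bar R}).

Lemma product_measure1_sigma_finite : sigma_finite setT (m1 \x m2).
Proof.
have /sigma_finiteP[F [FT ndF Ffin]] := sigma_finiteT m1.
have /sigma_finiteP[G [GT ndG Gfin]] := sigma_finiteT m2.
exists (fun n => F n `*` G n); last first.
  move=> n; have [mF fF] := Ffin n; have [mG fG] := Gfin n.
  split; first exact: measurableX.
  by rewrite product_measure1E// lte_mul_pinfty// ge0_fin_numE.
apply/seteqP; split => // -[x y] _.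
have [n _ Fx] : (\bigcup_n F n) x by rewrite -FT.
have [k _ Gy] : (\bigcup_n G n) y by rewrite -GT.
exists (n + k)%N => //; split => /=.
  by move: x Fx; apply/subsetPset/ndF/leq_addr.
by move: y Gy; apply/subsetPset/ndG/leq_addl.
Qed.

(** The product measure packed with its sigma-finiteness, so that it can be
    a factor of a further product in Fubini's theorem. *)
Definition sigma_finite_product : {sigma_finite_measure set (T1 * T2)%type -> \bar R} :=
  HB.pack (m1 \x m2) (Measure_isSigmaFinite.Build _ _ _ (m1 \x m2)
    product_measure1_sigma_finite).

End SigmaFiniteProduct.

Section Product.
Context d1 d2 (T1 : measurableType d1) (T2 : measurableType d2).
Variables (m1 : {sigma_finite_measure set T1 -> \bar R})
  (m2 : {sigma_finite_measure set T2 -> \bar R}).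
Variables (B1 : set T1) (B2 : set T2) (f : T1 * T2 -> R).
Hypotheses (mB1 : measurable B1) (mB2 : measurable B2).
Hypotheses (B1fin : m1 B1 < +oo) (B2fin : m2 B2 < +oo).
Hypothesis bf : bounded_supported (B1 `*` B2) f.

Lemma product_box_fin : (m1 \x m2) (B1 `*` B2) < +oo.
Proof. by rewrite product_measure1E// lte_mul_pinfty// ge0_fin_numE. Qed.

Lemma bounded_supported_slice1 y : bounded_supported B1 (fun x => f (x, y)).
Proof.
have [mf [k fk] f0] := bf; split.
- exact: (measurableT_comp mf (measurable_pair2 y)).
- by exists k => t; exact: fk.
- by move=> t tB; apply: f0 => -[].
Qed.

Lemma integral_prod_slice2_eq0 : (forall x, \int[m2]_y (f (x, y))%:E = 0) ->
  \int[m1 \x m2]_t (f t)%:E = 0.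
Proof.
move=> H; rewrite -(@integral12_prod_meas1 _ _ _ _ _ m1 m2 (EFin \o f)).
  by apply: integral0_eq => x _; exact: H.
apply: (@bounded_supported_integrable _ _ _ (B1 `*` B2)) => //.
  exact: measurableX.
exact: product_box_fin.
Qed.

Lemma integral_prod_slice1_eq0 : (forall y, \int[m1]_x (f (x, y))%:E = 0) ->
  \int[m1 \x m2]_t (f t)%:E = 0.
Proof.
move=> H; rewrite -(@integral21_prod_meas1 _ _ _ _ _ m1 m2 (EFin \o f)).
  by apply: integral0_eq => x _; exact: H.
apply: (@bounded_supported_integrable _ _ _ (B1 `*` B2)) => //.
  exact: measurableX.
exact: product_box_fin.
Qed.

End Product.

End CompactlySupportedIntegrals.

(** * The integral of a partial derivative with compact support *)
Section Leb4.
Variable R : realType.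
Local Notation RM := (measurableTypeR R).
Local Notation RM4 := (RM * RM * RM * RM)%type.
Implicit Types (F g : 'rV[R]_4 -> R).

Definition leb1 : {sigma_finite_measure set RM -> \bar R} := @lebesgue_measure R.
Definition leb2 := sigma_finite_product leb1 leb1.
Definition leb3 := sigma_finite_product leb2 leb1.

Definition itv1 (c : R) : set RM := [set` `[(- c)%R, c]].
Definition box4 (c : R) : set RM4 := itv1 c `*` itv1 c `*` itv1 c `*` itv1 c.

Lemma measurable_itv1 c : measurable (itv1 c).
Proof. exact: measurable_itv. Qed.

Lemma lebesgue_itv1_fin c : (leb1 (itv1 c) < +oo)%E.
Proof.
rewrite /leb1 /itv1 /= lebesgue_measure_itv/=.
by case: ifPn => // _; rewrite -EFinD ltry.
Qed.

Lemma norm_vec4_le (t : RM4) c : 0 <= c -> `|vec4 t| <= c -> box4 c t.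
Proof.
move=> c0 tc; have H i : `|vec4 t 0 i| <= c by exact: le_trans (rV_norm_coord _ i) tc.
have := (H 0, H 1, H 2%:R, H 3%:R); rewrite !mxE/= => -[[[h0 h1] h2] h3].
by rewrite /box4 /itv1 /=; do ![split]; rewrite in_itv/= -ler_norml.
Qed.

Lemma bounded_supported_vec4 g c : 0 <= c -> continuous g ->
  (forall x, c < `|x| -> g x = 0) ->
  bounded_supported (box4 c) (fun t : RM4 => g (vec4 t)).
Proof.
move=> c0 cg g0; split.
- have -> : [set: RM4] = [set t | [set: 'rV[R]_4] (vec4 t)] by apply/seteqP; split.
  by apply: measurable_vec4_comp; [exact: openT|move=> x _; exact: cg].
- have kK : compact [set x : 'rV[R]_4 | `|x| <= c].
    rewrite (_ : [set x | _] = [set x : 'rV[R]_4 | `|0 - x| <= c]).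
      exact: compact_norm_ball.
    by apply/seteqP; split => x /=; rewrite sub0r normrN.
  have [||x1 _ xmax] := compact_EVT_max _ kK (f := fun x => `|g x|).
  + by exists 0; rewrite /= normr0.
  + apply: continuous_subspaceT => x.
    by apply: (@cvg_norm _ _ _ (nbhs x) _ g (g x)); exact: cg.
  exists `|g x1| => t; have [tc|tc] := leP `|vec4 t| c.
    by apply: xmax; rewrite inE.
  by rewrite g0// normr0.
- move=> t tB; apply: g0; rewrite ltNge; apply/negP => tc.
  by apply: tB; exact: norm_vec4_le.
Qed.

Definition box2 c := itv1 c `*` itv1 c.
Definition box3 c := box2 c `*` itv1 c.

Lemma measurable_box2 c : measurable (box2 c).
Proof. by apply: measurableX; exact: measurable_itv1. Qed.

Lemma measurable_box3 c : measurable (box3 c).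
Proof. by apply: measurableX; [exact: measurable_box2|exact: measurable_itv1]. Qed.

Lemma measurable_box4 c : measurable (box4 c).
Proof. by apply: measurableX; [exact: measurable_box3|exact: measurable_itv1]. Qed.

Lemma leb2_box_fin c : (leb2 (box2 c) < +oo)%E.
Proof.
exact: (product_box_fin (measurable_itv1 c) (measurable_itv1 c)
  (lebesgue_itv1_fin c) (lebesgue_itv1_fin c)).
Qed.

Lemma leb3_box_fin c : (leb3 (box3 c) < +oo)%E.
Proof.
exact: (product_box_fin (measurable_box2 c) (measurable_itv1 c)
  (leb2_box_fin c) (lebesgue_itv1_fin c)).
Qed.

Lemma leb4_box_fin c : (@leb4 R (box4 c) < +oo)%E.
Proof.
exact: (product_box_fin (measurable_box3 c) (measurable_itv1 c)
  (leb3_box_fin c) (lebesgue_itv1_fin c)).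
Qed.

Lemma integrable_vec4 g c : 0 <= c -> continuous g ->
  (forall x, c < `|x| -> g x = 0) ->
  (@leb4 R).-integrable setT (EFin \o (fun t : RM4 => g (vec4 t))).
Proof.
move=> c0 cg g0; apply: (bounded_supported_integrable (B := box4 c)).
- exact: measurable_box4.
- exact: leb4_box_fin.
- exact: bounded_supported_vec4.
Qed.

(** The support condition passes to the line because its base point p has i-th
    coordinate 0, so that |s| <= |p + s e_i|. *)
Lemma line_integral_eq0 F c (i : 'I_4) (p : 'rV[R]_4) : 0 < c ->
  (forall x, C1_at F x) -> (forall x, c <= `|x| -> F x = 0) -> p 0 i = 0 ->
  (\int[@lebesgue_measure R]_s (partial i F (p + s *: delta_mx 0 i))%:E = 0)%E.
Proof.
move=> c0 CF F0 p0.
have lin : continuous (fun s : R => p + s *: (delta_mx 0 i : 'rV[R]_4)).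
  by move=> s; apply: cvgD; [exact: cvg_cst|exact: cvgZr_tmp].
have ple s : `|s| <= `|p + s *: (delta_mx 0 i : 'rV[R]_4)|.
  have := rV_norm_coord (p + s *: delta_mx 0 i) i.
  by rewrite !mxE !eqxx p0 add0r mulr1.
apply: (@integral_derivative_eq0 R (fun s => F (p + s *: delta_mx 0 i))
  (fun s => partial i F (p + s *: delta_mx 0 i)) c) => //.
- by move=> s; apply: is_derive_line; exact/diff_derivable/C1_at_diff.
- move=> s; apply: (@continuous_comp _ _ _ (fun s : R => p + s *: delta_mx 0 i)
    (partial i F)); first exact: lin.
  by have [_] := CF (p + s *: delta_mx 0 i).
- by move=> s cs; apply: F0; exact: le_trans (ple s).
- move=> s cs; apply: partial_near_eq0.
  have : \forall y \near p + s *: delta_mx 0 i, c < `|y|.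
    exact: (cvgr_gt _ (@norm_continuous _ _ _) _ (lt_le_trans cs (ple s))).
  by apply: filterS => y /ltW/F0.
Qed.

(** Integrating first along the i-th axis gives 0.  The product is
    ((R x R) x R) x R, so the i-th variable is reached by peeling off the last
    factors. *)
Lemma leb4_integral_partial_eq0 F c (i : 'I_4) : 0 < c ->
  (forall x, C1_at F x) -> (forall x, c <= `|x| -> F x = 0) ->
  (\int[@leb4 R]_t (partial i F (vec4 t))%:E = 0)%E.
Proof.
move=> c0 CF F0.
have pF0 x : c < `|x| -> partial i F x = 0.
  move=> cx; apply: partial_near_eq0.
  have : \forall y \near x, c < `|y| by exact: (cvgr_gt _ (@norm_continuous _ _ _) _ cx).
  by apply: filterS => y /ltW/F0.
have cpF : continuous (partial i F) by move=> x; have [_] := CF x; exact.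
have bF : bounded_supported (box4 c) (fun t : RM4 => partial i F (vec4 t)).
  by apply: bounded_supported_vec4 cpF pF0; exact: ltW.
have line (v : R -> 'rV[R]_4) : (forall s, v s = v 0 + s *: delta_mx 0 i) ->
    v 0 0 i = 0 -> (\int[@lebesgue_measure R]_s (partial i F (v s))%:E = 0)%E.
  move=> vE v0; rewrite -[RHS](line_integral_eq0 c0 CF F0 v0).
  by apply: eq_integral => s _; rewrite [in LHS]vE.
have m1 := measurable_itv1 c; have f1 := lebesgue_itv1_fin c.
have m2 := measurable_box2 c; have f2 := leb2_box_fin c.
have m3 := measurable_box3 c; have f3 := leb3_box_fin c.
have vecE (t : RM4) (s : R) (u : RM4) :
  (forall j : 'I_4, vec4 u 0 j = if j == i then s else vec4 t 0 j) -> vec4 t 0 i = 0 ->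
  vec4 u = vec4 t + s *: delta_mx 0 i.
  move=> H t0; apply/rowP => j; rewrite [LHS]H [RHS]mxE [X in _ + X]mxE.
  rewrite [X in _ + _ * X]mxE eqxx/=; case: eqVneq => [->|]; rewrite ?t0 ?mulr1 ?add0r//.
  by rewrite mulr0 addr0.
change (\int[leb3 \x leb1]_t (partial i F (vec4 t))%:E = 0)%E.
case: i bF line vecE {pF0 cpF} => -[|[|[|[|//]]]] h bF line vecE.
- apply: (integral_prod_slice1_eq0 m3 m1 f3 f1 bF) => x3.
  have bF3 := bounded_supported_slice1 bF x3.
  apply: (integral_prod_slice1_eq0 m2 m1 f2 f1 bF3) => x2.
  have bF2 := bounded_supported_slice1 bF3 x2.
  apply: (integral_prod_slice1_eq0 m1 m1 f1 f1 bF2) => x1.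
  apply: (line (fun s => vec4 (s, x1, x2, x3))); last by rewrite mxE.
  by move=> s; apply: vecE; [move=> [[|[|[|[|//]]]] ?]; rewrite !mxE|rewrite mxE].
- apply: (integral_prod_slice1_eq0 m3 m1 f3 f1 bF) => x3.
  have bF3 := bounded_supported_slice1 bF x3.
  apply: (integral_prod_slice1_eq0 m2 m1 f2 f1 bF3) => x2.
  have bF2 := bounded_supported_slice1 bF3 x2.
  apply: (integral_prod_slice2_eq0 m1 m1 f1 f1 bF2) => x1.
  apply: (line (fun s => vec4 (x1, s, x2, x3))); last by rewrite mxE.
  by move=> s; apply: vecE; [move=> [[|[|[|[|//]]]] ?]; rewrite !mxE|rewrite mxE].
- apply: (integral_prod_slice1_eq0 m3 m1 f3 f1 bF) => x3.
  have bF3 := bounded_supported_slice1 bF x3.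
  apply: (integral_prod_slice2_eq0 m2 m1 f2 f1 bF3) => x2.
  apply: (line (fun s => vec4 (x2, s, x3))); last by rewrite mxE.
  by move=> s; apply: vecE; [move=> [[|[|[|[|//]]]] ?]; rewrite !mxE|rewrite mxE].
- apply: (integral_prod_slice2_eq0 m3 m1 f3 f1 bF) => x.
  apply: (line (fun s => vec4 (x, s))); last by rewrite mxE.
  by move=> s; apply: vecE; [move=> [[|[|[|[|//]]]] ?]; rewrite !mxE|rewrite mxE].
Qed.

End Leb4.

(** * Classical partial derivatives are weak ones *)
Section WeakPartial.
Variable R : realType.
Local Notation RM := (measurableTypeR R).
Local Notation RM4 := (RM * RM * RM * RM)%type.
Implicit Types (U K : set 'rV[R]_4) (f u eta : 'rV[R]_4 -> R).

(** A function vanishing off a compact subset of U is extended by zero: in a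
    chart it comes from a product whose other factor is meaningless outside
    U. *)
Definition cut_off U f : 'rV[R]_4 -> R := fun x => if `[< U x >] then f x else 0.

Lemma cut_off_in U f x : U x -> cut_off U f x = f x.
Proof. by move=> Ux; rewrite /cut_off asboolT. Qed.

Lemma cut_off_near_in U f x : open U -> U x ->
  \forall y \near x, f y = cut_off U f y.
Proof.
move=> oU Ux; have : \forall y \near x, U y by exact: open_nbhs_nbhs.
by apply: filterS => y Uy; rewrite cut_off_in.
Qed.

Lemma cut_off_near_out U K f x : compact K -> K `<=` U ->
  (forall y, ~ K y -> f y = 0) -> ~ U x -> \forall y \near x, cut_off U f y = 0.
Proof.
move=> kK KU f0 nUx.
have : \forall y \near x, (~` K) y.
  apply: open_nbhs_nbhs; split; last by move=> /KU.
  by apply: closed_openC; apply: compact_closed => //; exact: norm_hausdorff.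
by apply: filterS => y /f0 fy; rewrite /cut_off; case: ifP.
Qed.

Lemma compact_norm_bounded K : compact K ->
  exists2 c : R, 0 < c & forall x, c <= `|x| -> ~ K x.
Proof.
move=> /compact_bounded[m [mr bK]].
exists (`|m| + 2) => [|x cx Kx]; first by rewrite ltr_wpDl.
have := bK (`|m| + 1) _ x Kx; rewrite (le_lt_trans (ler_norm _)) ?ltrDl//.
by move=> /(_ isT) /=; lra.
Qed.

Lemma cut_off_supp U K f x : K `<=` U -> (forall y, ~ K y -> f y = 0) ->
  ~ K x -> cut_off U f x = 0.
Proof. by move=> KU f0 Kx; rewrite /cut_off f0//; case: ifP. Qed.

Lemma cut_off_continuous U K f : open U -> compact K -> K `<=` U ->
  (forall y, ~ K y -> f y = 0) -> (forall x, U x -> {for x, continuous f}) ->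
  continuous (cut_off U f).
Proof.
move=> oU kK KU f0 cf x; have [Ux|nUx] := pselect (U x).
  apply: near_eq_continuous (cf x Ux).
  by have := cut_off_near_in f oU Ux; apply: filterS.
have := cut_off_near_out kK KU f0 nUx => h.
apply: (near_eq_continuous (g := fun=> 0) h); exact: cst_continuous.
Qed.

Lemma cut_off_C1 U K f : open U -> compact K -> K `<=` U ->
  (forall y, ~ K y -> f y = 0) -> (forall x, U x -> C1_at f x) ->
  forall x, C1_at (cut_off U f) x.
Proof.
move=> oU kK KU f0 cf x; have [Ux|nUx] := pselect (U x).
  by apply: C1_at_near_eq (cf x Ux); exact: cut_off_near_in.
have := cut_off_near_out kK KU f0 nUx => h.
apply: (@C1_at_near_eq _ (fun=> 0)); last exact: C1_at_cst.
by apply: filterS h => y ->.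
Qed.

Lemma partial_cut_off U K f i x : open U -> compact K -> K `<=` U ->
  (forall y, ~ K y -> f y = 0) ->
  partial i (cut_off U f) x = cut_off U (partial i f) x.
Proof.
move=> oU kK KU f0; have [Ux|nUx] := pselect (U x).
  rewrite cut_off_in//; apply: near_eq_derive.
  by have := cut_off_near_in f oU Ux; apply: filterS => y ->.
have := cut_off_near_out kK KU f0 nUx => h.
by rewrite [RHS]/cut_off asboolF//; exact: partial_near_eq0.
Qed.

Lemma Rint4_cut_off U f : Rint4 U f = \int[@leb4 R]_t cut_off U f (vec4 t).
Proof.
rewrite /Rint4 Rintegral_mkcond; apply: eq_Rintegral => t _.
rewrite patchE; have [Ut|nUt] := pselect (U (vec4 t)).
  by rewrite mem_set// cut_off_in.
by rewrite memNset// /cut_off asboolF.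
Qed.

(** The product u eta, extended by zero, has partial derivatives of integral 0. *)
Lemma integration_by_parts_test U u eta i : open U ->
  (forall x, U x -> C1_at u x) -> test_function U eta ->
  Rint4 U (fun x => u x * partial i eta x) =
  - Rint4 U (fun x => partial i u x * eta x).
Proof.
move=> oU cu [seta [K [kK KU eta0]]].
have ceta x : C1_at eta x by apply: (Ck_on_C1_at openT (seta 1%N)).
have peta0 y : ~ K y -> partial i eta y = 0.
  move=> nKy; apply: partial_near_eq0.
  have : \forall x \near y, (~` K) x.
    apply: open_nbhs_nbhs; split => //.
    by apply: closed_openC; apply: compact_closed => //; exact: norm_hausdorff.
  by apply: filterS => x /eta0.
pose f1 x := u x * partial i eta x; pose f2 x := partial i u x * eta x.
have f10 y : ~ K y -> f1 y = 0 by move=> Ky; rewrite /f1 peta0// mulr0.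
have f20 y : ~ K y -> f2 y = 0 by move=> Ky; rewrite /f2 eta0// mulr0.
have f0 y : ~ K y -> u y * eta y = 0 by move=> Ky; rewrite eta0// mulr0.
have [c c0 cK] := compact_norm_bounded kK.
have cf1 : continuous (cut_off U f1).
  apply: (cut_off_continuous oU kK KU f10) => x Ux.
  apply: continuousM; first exact/C1_at_continuous/cu.
  by have [_] := ceta x; exact.
have cf2 : continuous (cut_off U f2).
  apply: (cut_off_continuous oU kK KU f20) => x Ux.
  apply: continuousM; last exact/C1_at_continuous/ceta.
  by have [_] := cu x Ux; exact.
have i1 : (@leb4 R).-integrable setT (EFin \o (fun t : RM4 => cut_off U f1 (vec4 t))).
  apply: (@integrable_vec4 _ _ c (ltW c0) cf1) => x /ltW/cK.
  exact: cut_off_supp.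
have i2 : (@leb4 R).-integrable setT (EFin \o (fun t : RM4 => cut_off U f2 (vec4 t))).
  apply: (@integrable_vec4 _ _ c (ltW c0) cf2) => x /ltW/cK.
  exact: cut_off_supp.
rewrite !Rint4_cut_off; apply/eqP; rewrite -addr_eq0 -RintegralD//; apply/eqP.
have C1F : forall x, C1_at (cut_off U (fun x => u x * eta x)) x.
  by apply: (cut_off_C1 oU kK KU f0) => x Ux; apply: C1_atM => //; exact: cu.
have F0 x : c <= `|x| -> cut_off U (fun x => u x * eta x) x = 0.
  by move=> /cK; exact: cut_off_supp.
rewrite /Rintegral -[RHS]/(fine 0%:E); congr fine.
apply: etrans (leb4_integral_partial_eq0 i c0 C1F F0).
apply: eq_integral => t _; congr (_%:E).
rewrite (partial_cut_off _ _ oU kK KU f0).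
rewrite /cut_off; case: ifP => [/asboolP Ut|_]; last by rewrite addr0.
rewrite partialM; first by rewrite /f1 /f2.
  exact/C1_at_diff/cu.
exact/C1_at_diff/ceta.
Qed.

End WeakPartial.

(** * Charts and tensors *)
Section Charts.
Variables (R : realType) (M : ptopologicalType).
Implicit Types (phi psi : chart R M) (p : M).

Lemma cimg_cmap phi p : cdom phi p -> cimg phi (cmap phi p).
Proof. by move=> ?; exists p. Qed.

Lemma cinvK phi x : is_chart phi -> cimg phi x -> cmap phi (cinv phi x) = x.
Proof. by move=> [_ _ K _ _] [p dp <-]; rewrite K. Qed.

Lemma cinv_dom phi x : is_chart phi -> cimg phi x -> cdom phi (cinv phi x).
Proof. by move=> [_ _ K _ _] [p dp <-]; rewrite K. Qed.

Lemma cmap_continuous phi p : is_chart phi -> cdom phi p ->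
  {for p, continuous (cmap phi)}.
Proof.
move=> [oD _ _ cm _] dp.
by move: cm; rewrite continuous_open_subspace// => /(_ p); rewrite inE; apply.
Qed.

Lemma cinv_continuous phi x : is_chart phi -> cimg phi x ->
  {for x, continuous (cinv phi)}.
Proof.
move=> [_ oI _ _ ci] ix.
by move: ci; rewrite continuous_open_subspace// => /(_ x); rewrite inE; apply.
Qed.

Lemma near_cdom phi p : is_chart phi -> cdom phi p -> \forall p' \near p, cdom phi p'.
Proof. by move=> [oD _ _ _ _] dp; exact: open_nbhs_nbhs. Qed.

(** How continuity on M is read off in a chart. *)
Lemma continuous_from_chart phi (f : M -> R) (h : 'rV[R]_4 -> R) p :
  is_chart phi -> cdom phi p ->
  (forall p', cdom phi p' -> f p' = h (cmap phi p')) ->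
  {for cmap phi p, continuous h} -> {for p, continuous f}.
Proof.
move=> cphi dp fh hc.
apply: (near_eq_continuous (g := fun p' => h (cmap phi p'))).
  by have := near_cdom cphi dp; apply: filterS => p' /fh.
exact: (continuous_comp (cmap_continuous cphi dp) hc).
Qed.

Lemma chart_open_preimage phi (V : set 'rV[R]_4) : is_chart phi -> open V ->
  open (cdom phi `&` cmap phi @^-1` V).
Proof.
move=> cphi oV; apply: open_preimage_at => //; first by case: cphi.
by move=> p; exact: cmap_continuous.
Qed.

End Charts.

Section BorelManifold.
Variables (R : realType) (M : ptopologicalType).

Lemma borel_open (V : set M) : open V -> measurable (V : set (borel M)).
Proof. by move=> oV; apply: sub_sigma_algebra. Qed.

Lemma measurable_fun_continuous_at (D : set M) (f : M -> R) : open D ->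
  (forall p, D p -> {for p, continuous f}) ->
  measurable_fun (D : set (borel M)) (f : borel M -> R).
Proof.
move=> oD cf mD; apply: (measurability _ (RGenOpens.measurableE R)) => //.
move=> _ [_ [a [b ->] <-]]; apply: borel_open.
by apply: open_preimage_at.
Qed.

End BorelManifold.

Section Tensors.
Variables (R : realType) (M : ptopologicalType).
Variables (A : set (chart R M)) (g0 : chart R M -> 'rV[R]_4 -> 'M[R]_4).
Hypothesis mfd : smooth_atlas A.
Hypothesis riem : riemannian_metric A g0.
Implicit Types (phi psi : chart R M) (p : M) (u : M -> R).

Lemma atlas_chart phi : A phi -> is_chart phi.
Proof. by case: mfd => + _ _; apply. Qed.

Lemma atlas_cover p : exists2 phi, A phi & cdom phi p.
Proof. by case: mfd => _ + _; apply. Qed.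

Lemma cimg_open phi : A phi -> open (cimg phi).
Proof. by move=> /atlas_chart[]. Qed.

Lemma metric_posdef phi x : A phi -> cimg phi x -> posdef (g0 phi x).
Proof.
case: riem => _ sym pos _ Aphi ix; split; first exact: sym.
by move=> v v0; exact: pos.
Qed.

Lemma metric_C1 phi x i j : A phi -> cimg phi x -> C1_at (fun y => g0 phi y i j) x.
Proof.
move=> Aphi ix; case: riem => sm _ _ _.
exact: (Ck_on_C1_at (cimg_open Aphi) (sm phi Aphi i j 1%N) ix).
Qed.

Lemma Ck_fun_C1 k u phi x : Ck_fun A k.+1 u -> A phi -> cimg phi x ->
  C1_at (u \o cinv phi) x.
Proof.
by move=> cu Aphi ix; exact: (Ck_on_C1_at (cimg_open Aphi) (cu phi Aphi) ix).
Qed.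

Lemma Ck_fun_C1_partial k u phi x i : Ck_fun A k.+2 u -> A phi -> cimg phi x ->
  C1_at (partial i (u \o cinv phi)) x.
Proof.
move=> cu Aphi ix; apply: (Ck_on_C1_at (cimg_open Aphi) _ ix).
exact: Ck_on_partial (cu phi Aphi).
Qed.

Lemma Ck_fun_continuous k u : Ck_fun A k u -> continuous u.
Proof.
move=> cu p; have [phi Aphi dp] := atlas_cover p.
have cphi := atlas_chart Aphi.
apply: (continuous_from_chart (h := u \o cinv phi) cphi dp).
  by move=> p' dp'; case: cphi => _ _ K _ _ /=; rewrite K.
exact: (Ck_on_continuous (cu phi Aphi) (cimg_cmap dp)).
Qed.

Lemma overlap_open phi psi : A phi -> A psi ->
  open (cmap phi @` (cdom phi `&` cdom psi)).
Proof.
move=> Aphi Apsi; have cphi := atlas_chart Aphi; have cpsi := atlas_chart Apsi.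
have -> : cmap phi @` (cdom phi `&` cdom psi) = cimg phi `&` cinv phi @^-1` cdom psi.
  apply/seteqP; split => [_ [p [dp dp'] <-]|x [ix dx]].
    by split; [exact: cimg_cmap|case: cphi => _ _ K _ _; rewrite /= K].
  by exists (cinv phi x); [split => //; exact: cinv_dom|exact: cinvK].
apply: open_preimage_at; first exact: cimg_open.
  by move=> x; exact: cinv_continuous.
by case: cpsi.
Qed.

(** The chain rule for u o phi^-1 = (u o psi^-1) o (psi o phi^-1). *)
Lemma differential_covector u : Ck_fun A 1 u -> covector_field A (differential u).
Proof.
move=> cu phi psi p Aphi Apsi dp dp'.
have cphi := atlas_chart Aphi; have cpsi := atlas_chart Apsi.
have oW := overlap_open Aphi Apsi.
have Wx : (cmap phi @` (cdom phi `&` cdom psi)) (cmap phi p) by exists p.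
have Tx : transition phi psi (cmap phi p) = cmap psi p.
  by rewrite /transition/=; case: cphi => _ _ -> .
have dT j : differentiable (fun y => transition phi psi y 0 j) (cmap phi p).
  apply: C1_at_diff; case: mfd => _ _ sm.
  exact: (Ck_on_C1_at oW (sm phi psi Aphi Apsi j 1%N) Wx).
apply/rowP => i; rewrite !mxE.
have -> : partial i (u \o cinv phi) (cmap phi p) =
    partial i ((u \o cinv psi) \o transition phi psi) (cmap phi p).
  apply: near_eq_derive.
  have : \forall y \near cmap phi p, (cmap phi @` (cdom phi `&` cdom psi)) y.
    exact: open_nbhs_nbhs.
  apply: filterS => _ [q [dq dq'] <-] /=.
  by rewrite /transition/=; case: cphi cpsi => _ _ K _ _ [_ _ K' _ _]; rewrite K// K'.
rewrite /partial derive_comp_row//; last first.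
  by rewrite Tx; apply/C1_at_diff/(Ck_fun_C1 cu Apsi)/cimg_cmap.
by apply: eq_bigr => j _; rewrite !mxE Tx mulrC.
Qed.

Definition sqnorm_loc phi (w : chart R M -> 'rV[R]_4 -> 'rV[R]_4) (x : 'rV[R]_4) : R :=
  \sum_i \sum_j metric_inv (g0 phi) x i j * w phi x 0 i * w phi x 0 j.

Lemma sqnorm_locE phi w x :
  sqnorm_loc phi w x = (w phi x *m invmx (g0 phi x) *m (w phi x)^T) 0 0.
Proof. by rewrite quadratic_formE. Qed.

(** If G = J G' J^T and w = w' J^T then w G^-1 w^T = w' G'^-1 w'^T; the Jacobian
    J is invertible because G is. *)
Lemma sqnorm_loc_invariant w phi psi p : covector_field A w -> A phi -> A psi ->
  cdom phi p -> cdom psi p ->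
  sqnorm_loc phi w (cmap phi p) = sqnorm_loc psi w (cmap psi p).
Proof.
move=> cw Aphi Apsi dp dp'; rewrite !sqnorm_locE.
have pG := metric_posdef Aphi (cimg_cmap dp).
have pG' := metric_posdef Apsi (cimg_cmap dp').
have [_ _ _ tr] := riem; have := tr phi psi p Aphi Apsi dp dp'.
rewrite (cw phi psi p Aphi Apsi dp dp') /=.
move: (transition_jac _ _ _) (w _ _) pG pG' => J v.
move: (g0 phi _) (g0 psi _) => G G' pG pG' GE.
have uG : G \in unitmx by rewrite unitmxE unitfE posdef_unit.
have uG' : G' \in unitmx by rewrite unitmxE unitfE posdef_unit.
have uJ : J \in unitmx by move: uG; rewrite GE !unitmx_mul => /andP[/andP[]].
have uJT : J^T \in unitmx by rewrite unitmx_tr.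
have XG : J^T *m invmx G *m J *m G' = 1%:M.
  rewrite -[LHS](mulmxK uJT) -!mulmxA (mulmxA J) (mulmxA (J *m G')) -GE.
  by rewrite (mulmxA (invmx G)) mulVmx// mul1mx mulmxV.
have -> : invmx G' = J^T *m invmx G *m J.
  by rewrite -[RHS](mulmxK uG') XG mul1mx.
by rewrite trmx_mul trmxK !mulmxA.
Qed.

(** By invariance the set from which [sqnorm] picks its value is a
    singleton. *)
Lemma sqnormE w phi p : covector_field A w -> A phi -> cdom phi p ->
  sqnorm A g0 w p = sqnorm_loc phi w (cmap phi p).
Proof.
move=> cw Aphi dp; apply: xget_unique.
  by exists phi.
move=> r [psi [Apsi dp' ->]].
exact: (sqnorm_loc_invariant cw Apsi Aphi dp' dp).
Qed.

Lemma sqnorm_differential_continuous u : Ck_fun A 1 u ->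
  continuous (sqnorm A g0 (differential u)).
Proof.
move=> cu p; have [phi Aphi dp] := atlas_cover p.
have cw := differential_covector cu.
apply: (continuous_from_chart (h := sqnorm_loc phi (differential u))
  (atlas_chart Aphi) dp) => [p' dp'|]; first exact: sqnormE.
have ix := cimg_cmap dp.
have cpart i : {for cmap phi p, continuous (fun x => differential u phi x 0 i)}.
  rewrite (_ : (fun x => _) = partial i (u \o cinv phi)).
    by have [_] := Ck_fun_C1 cu Aphi ix; exact.
  by apply/funext => x; rewrite mxE.
apply: continuous_at_sum => i; apply: continuous_at_sum => j.
apply: (@continuousM _ _ (fun x => metric_inv (g0 phi) x i j * differential u phi x 0 i)
  (fun x => differential u phi x 0 j)) => //.
apply: (@continuousM _ _ (fun x => metric_inv (g0 phi) x i j)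
  (fun x => differential u phi x 0 i)) => //.
apply: C1_at_continuous; apply: C1_at_invmx.
  exact: posdef_unit (metric_posdef Aphi ix).
by move=> k l; exact: metric_C1.
Qed.

End Tensors.

(** * Finite volume and sign of the energy *)
Section Volume.
Variables (R : realType) (M : ptopologicalType).
Variables (A : set (chart R M)) (g0 : chart R M -> 'rV[R]_4 -> 'M[R]_4).
Variable dV : {measure set (borel M) -> \bar R}.
Hypothesis cptM : compact [set: M].
Hypothesis mfd : smooth_atlas A.
Hypothesis riem : riemannian_metric A g0.
Hypothesis vol : riemannian_volume A g0 dV.
Implicit Types (phi psi : chart R M) (p : M) (u : M -> R).
Local Notation RM := (measurableTypeR R).
Local Notation RM4 := (RM * RM * RM * RM)%type.

(** The defining formula of the Riemannian measure, tested on an indicator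
    function. *)
Lemma volume_chart_preimage phi (V : set 'rV[R]_4) : A phi -> open V ->
  V `<=` cimg phi ->
  dV (cdom phi `&` cmap phi @^-1` V) =
  (\int[@leb4 R]_(t in [set t | V (vec4 t)]) (volume_density (g0 phi) (vec4 t))%:E)%E.
Proof.
move=> Aphi oV Vsub; have cphi := atlas_chart mfd Aphi.
set W := _ `&` _.
have mW : measurable (W : set (borel M)) by apply: borel_open; exact: chart_open_preimage.
have mD : measurable (cdom phi : set (borel M)) by apply: borel_open; case: cphi.
have -> : dV W = (\int[dV]_(p in (cdom phi : set (borel M))) (\1_W p)%:E)%E.
  by rewrite integral_indic// setIidl// => p [].
rewrite (vol Aphi (f := fun p => (\1_W p)%:E)); last 2 first.
- by apply: measurable_funTS; apply/measurable_EFinP; exact: measurable_indic.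
- by move=> p _; rewrite lee_fin.
rewrite integral_mkcond [RHS]integral_mkcond; apply: eq_integral => t _.
rewrite !patchE; have [Vt|nVt] := pselect (V (vec4 t)).
  have it := Vsub _ Vt; rewrite mem_set// [in RHS]mem_set//.
  rewrite indicE mem_set ?mul1e//; split; first exact: cinv_dom.
  by rewrite /= cinvK.
rewrite [in RHS]memNset//; case: ifPn => // /set_mem it.
by rewrite indicE memNset ?mul0e// => -[_] /=; rewrite cinvK.
Qed.

(** The volume density is bounded on a small coordinate cube, and the cube has
    finite Lebesgue measure. *)
Lemma locally_finite_volume p : exists V : set M,
  [/\ open V, V p & (dV V < +oo)%E].
Proof.
have [phi Aphi dp] := atlas_cover mfd p.
have cphi := atlas_chart mfd Aphi.
have ix := cimg_cmap dp.
have cdens : {for cmap phi p, continuous (volume_density (g0 phi))}.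
  apply: C1_at_continuous; apply: (@C1_at_volume_density _ (cimg phi)) => //.
  - by move=> x jx; exact: (metric_posdef riem Aphi jx).
  - by move=> x i j jx; exact: (metric_C1 mfd riem _ _ Aphi jx).
pose k := volume_density (g0 phi) (cmap phi p) + 1.
have n1 : \forall x \near cmap phi p, volume_density (g0 phi) x < k.
  by apply: (cvgr_lt (f := volume_density (g0 phi)) _ cdens); rewrite ltrDl.
have n2 : \forall x \near cmap phi p, cimg phi x.
  by apply: open_nbhs_nbhs; split => //; exact: (cimg_open mfd).
have : \forall x \near cmap phi p, cimg phi x /\ volume_density (g0 phi) x < k.
  exact: filterI.
move=> /nbhs_ballP[r /= r0 rP].
pose B := ball (cmap phi p) r.
exists (cdom phi `&` cmap phi @^-1` B); split.
- by apply: chart_open_preimage => //; exact: ball_open.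
- by split => //; exact: ballxx.
have oB : open B by exact: ball_open.
rewrite volume_chart_preimage//; last by move=> x /rP[].
have mB : measurable [set t : RM4 | B (vec4 t)] by exact: measurable_vec4_open.
apply: integrable_lty => //; apply: measurable_bounded_integrable => //.
- pose c := `|cmap phi p| + r.
  apply: le_lt_trans (leb4_box_fin c).
  apply: le_measure; rewrite ?inE//; first exact: measurable_box4.
  move=> t /= Bt; apply: norm_vec4_le; first by rewrite addr_ge0// ltW.
  move: Bt; rewrite /B -ball_normE/= => Bt.
  rewrite -[vec4 t](subKr (cmap phi p)) (le_trans (ler_normB _ _))// lerD2l.
  exact: ltW.
- apply: measurable_vec4_comp => // x Bx; apply: C1_at_continuous.
  apply: (@C1_at_volume_density _ (cimg phi)); last by have [] := rP x Bx.
  - by move=> y jy; exact: (metric_posdef riem Aphi jy).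
  - by move=> y i j jx; exact: (metric_C1 mfd riem _ _ Aphi jx).
- exists k; split; first exact: num_real.
  move=> m km t /= Bt; rewrite ger0_norm ?sqrtr_ge0//.
  by have [_] := rP _ Bt => /ltW/le_trans; apply; exact: ltW.
Qed.

Lemma volume_finite : (dV setT < +oo)%E.
Proof.
have /choice[V VP] := locally_finite_volume.
have oV p : open (V p) by case: (VP p).
have := cptM; rewrite compact_cover => /(_ M [set: M] V) [].
- by move=> p _; exact: oV.
- by move=> p _; exists p => //; case: (VP p).
move=> D _ cov.
have fin (s : seq M) : (dV (\big[setU/set0]_(p <- s) V p) < +oo)%E /\
    measurable (\big[setU/set0]_(p <- s) V p : set (borel M)).
  elim: s => [|p s [IH mIH]]; first by rewrite big_nil measure0.
  have mV : measurable (V p : set (borel M)) by exact: borel_open.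
  rewrite big_cons; split; last exact: measurableU.
  apply: (le_lt_trans (measureU2 _ mV mIH)).
  by apply: lte_add_pinfty => //; case: (VP p).
have [f1 m1] := fin (finmap.enum_fset D).
apply: le_lt_trans f1; apply: le_measure; rewrite ?inE//.
move=> p _; have [q qD Vq] := cov p I.
by rewrite -bigcup_fset; exists q.
Qed.

Lemma continuous_integrable (f : M -> R) : continuous f ->
  dV.-integrable setT (fun p : borel M => (f p)%:E).
Proof.
move=> cf; apply: measurable_bounded_integrable => //; first exact: volume_finite.
  by apply: measurable_fun_continuous_at; [exact: openT|move=> p _; exact: cf].
have [||q _ qmax] := compact_EVT_max _ cptM (f := fun p => `|f p|).
- by exists point.
- apply: continuous_subspaceT => p.
  by apply: (@cvg_norm _ _ _ (nbhs p) _ f (f p)); exact: cf.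
exists `|f q|; split; first exact: num_real.
by move=> m fm p _ /=; apply: le_trans (ltW fm); apply: qmax; rewrite inE.
Qed.

Lemma sobolev_H1_C1 u : Ck_fun A 1 u -> sobolev_H1 A g0 dV u (differential u).
Proof.
move=> cu; have uc := Ck_fun_continuous mfd cu; split.
- by apply: measurable_fun_continuous_at; [exact: openT|move=> p _; exact: uc].
- move=> phi i Aphi; have cphi := atlas_chart mfd Aphi.
  apply: measurable_fun_continuous_at; first by case: cphi.
  move=> p dp; apply: (continuous_from_chart
    (h := partial i (u \o cinv phi)) cphi dp) => [p' _|]; first by rewrite mxE.
  by have [_] := Ck_fun_C1 mfd cu Aphi (cimg_cmap dp); exact.
- by apply: continuous_integrable => p; exact: (continuousM (uc p) (uc p)).
- by apply: continuous_integrable; exact: sqnorm_differential_continuous.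
- split; first exact: differential_covector.
  move=> phi Aphi i eta teta.
  have := @integration_by_parts_test R (cimg phi) (u \o cinv phi) eta i
    (cimg_open mfd Aphi) (fun x => Ck_fun_C1 mfd cu Aphi) teta.
  move=> ->; congr (- Rint4 _ _); apply/funext => x.
  by rewrite mxE.
Qed.

(** When the total volume is positive, u is a competitor in the infimum defining
    the first eigenvalue, and its denominator \int u^2 is positive, u being
    bounded below by a positive constant.  When it is zero, the energy is 0. *)
Lemma energy_ge0 a c u : continuous a -> continuous c ->
  (0 <= first_eigenvalue A g0 dV a c)%E ->
  Ck_fun A 1 u -> (forall p, 0 < u p) -> 0 <= energy A g0 dV a c u (differential u).
Proof.
move=> ca cc l0 cu u0; have uc := Ck_fun_continuous mfd cu.
have u2c : continuous (fun p => u p ^+ 2) by move=> p; exact: (continuousM (uc p) (uc p)).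
have sc := sqnorm_differential_continuous mfd riem cu.
have cE : continuous (fun p => a p * sqnorm A g0 (differential u) p + c p * u p ^+ 2).
  move=> p; apply: (@continuousD _ _ _ (fun p => a p * sqnorm A g0 (differential u) p)
    (fun p => c p * u p ^+ 2)).
    exact: (@continuousM _ _ a (sqnorm A g0 (differential u)) p (ca p) (sc p)).
  exact: (@continuousM _ _ c (fun p => u p ^+ 2) p (cc p) (u2c p)).
have [V0|V0] := eqVneq (dV setT) 0%E.
  rewrite /energy /Rintegral null_set_integral//.
  apply/measurable_EFinP; apply: measurable_fun_continuous_at; first exact: openT.
  by move=> p _; exact: cE.
have V1 : 0 < fine (dV setT).
  by rewrite fine_gt0// lt0e V0 measure_ge0 volume_finite.
have [||q _ qmin] := compact_EVT_min _ cptM (f := u).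
- by exists point.
- exact: continuous_subspaceT.
have I2 : 0 < \int[dV]_p (u p ^+ 2).
  apply: (@lt_le_trans _ _ (\int[dV]_p (u q ^+ 2))).
    by rewrite Rintegral_cst// mulr_gt0// exprn_gt0.
  apply: le_Rintegral => //.
  - by apply: continuous_integrable; exact: cst_continuous.
  - exact: continuous_integrable.
  - by move=> p _; rewrite ler_pXn2r ?nnegrE ?(ltW (u0 _))//; apply: qmin; rewrite inE.
have : (0 <= (energy A g0 dV a c u (differential u) / \int[dV]_p (u p ^+ 2))%:E)%E.
  apply: le_trans l0 _; apply: ereal_inf_lbound.
  exists u, (differential u); split => //; first exact: sobolev_H1_C1.
  move=> [N [mN N0 sub]]; move/eqP: V0; apply.
  apply/eqP; rewrite eq_le measure_ge0 andbT -[leRHS]N0.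
  apply: le_measure; rewrite ?inE//.
  by move=> p _; apply: sub => /=; apply/eqP; rewrite gt_eqF.
by rewrite lee_fin pmulr_lge0 ?invr_gt0.
Qed.

End Volume.

(** * Comparison of two solutions *)
Section Comparison.
Variables (R : realType) (M : ptopologicalType).
Variables (A : set (chart R M)) (g0 : chart R M -> 'rV[R]_4 -> 'M[R]_4).
Variables a c : M -> R.
Hypothesis mfd : smooth_atlas A.
Hypothesis riem : riemannian_metric A g0.
Hypothesis sa : smooth_fun A a.
Hypothesis sc : smooth_fun A c.
Hypothesis a_gt0 : forall p, 0 < a p.
Implicit Types (phi : chart R M) (p : M) (u v : M -> R).

Local Notation principal phi := (principal_part (g0 phi) (a \o cinv phi)).
Local Notation drift_coef phi := (drift (g0 phi) (a \o cinv phi)).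
Local Notation diff_part phi := (nondiv_operator (g0 phi) (a \o cinv phi)).

Lemma LopE phi v x : A phi -> cimg phi x -> Ck_fun A 2 v ->
  Lop g0 a c phi v x =
  - diff_part phi (v \o cinv phi) x + c (cinv phi x) * v (cinv phi x).
Proof.
move=> Aphi ix cv; rewrite /Lop; congr (- _ + _).
apply: (@divergence_locE _ (cimg phi) (g0 phi) (a \o cinv phi)) => //.
- by move=> y iy; exact: (metric_posdef riem Aphi iy).
- by move=> y i j iy; exact: (metric_C1 mfd riem _ _ Aphi iy).
- by move=> y iy; exact: (Ck_fun_C1 mfd (sa 1%N) Aphi iy).
- by move=> i; exact: (Ck_fun_C1_partial mfd i cv Aphi ix).
Qed.

Lemma nondiv_operator_lincomb (G : 'rV[R]_4 -> 'M[R]_4) al k f g x :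
  C1_at f x -> C1_at g x ->
  (forall i, C1_at (partial i f) x) -> (forall i, C1_at (partial i g) x) ->
  nondiv_operator G al (fun y => f y + k * g y) x =
  nondiv_operator G al f x + k * nondiv_operator G al g x.
Proof.
move=> cf cg cf2 cg2; rewrite /nondiv_operator mulrDr addrACA; congr (_ + _).
  rewrite mulr_sumr -big_split/=; apply: eq_bigr => i _.
  rewrite mulr_sumr -big_split/=; apply: eq_bigr => j _.
  by rewrite (partial2_lincomb i k cf cg (cf2 j) (cg2 j)) mulrDr [_ * (k * _)]mulrCA.
rewrite mulr_sumr -big_split/=; apply: eq_bigr => i _.
rewrite partial_lincomb; [|exact: C1_at_diff|exact: C1_at_diff].
by rewrite mulrDr [_ * (k * _)]mulrCA.
Qed.

Lemma diff_part_lincomb phi k u v x : A phi -> cimg phi x ->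
  Ck_fun A 2 u -> Ck_fun A 2 v ->
  diff_part phi (fun y => u (cinv phi y) + k * v (cinv phi y)) x =
  diff_part phi (u \o cinv phi) x + k * diff_part phi (v \o cinv phi) x.
Proof.
move=> Aphi ix cu cv.
apply: (@nondiv_operator_lincomb _ _ k (u \o cinv phi) (v \o cinv phi)).
- exact: (Ck_fun_C1 mfd cu Aphi ix).
- exact: (Ck_fun_C1 mfd cv Aphi ix).
- by move=> i; exact: (Ck_fun_C1_partial mfd i cu Aphi ix).
- by move=> i; exact: (Ck_fun_C1_partial mfd i cv Aphi ix).
Qed.

Lemma principal_posdef phi x : A phi -> cimg phi x -> posdef (principal phi x).
Proof.
move=> Aphi ix; apply: (@posdef_principal_part _ (cimg phi)) => //.
- by move=> y iy; exact: (metric_posdef riem Aphi iy).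
- by move=> y iy; exact: a_gt0.
Qed.

(** At p the function u1 - m u2 has a maximum, so the second-order part of the
    operator is nonpositive on it; as the function itself is 0 there, this says
    K1 u1^-5 >= m K2 u2^-5 at p, with u1 = m u2. *)
Lemma touching_coefficients (K1 K2 m : R) u1 u2 p :
  Ck_fun A 2 u1 -> Ck_fun A 2 u2 ->
  (forall p, 0 < u2 p) -> 0 < m ->
  (forall phi p, A phi -> cdom phi p ->
    Lop g0 a c phi u1 (cmap phi p) = K1 * u1 p ^- 5) ->
  (forall phi p, A phi -> cdom phi p ->
    Lop g0 a c phi u2 (cmap phi p) = K2 * u2 p ^- 5) ->
  (forall q, u1 q <= m * u2 q) -> u1 p = m * u2 p ->
  m ^+ 6 * K2 <= K1.
Proof.
move=> cu1 cu2 u20 m0 e1 e2 le12 eq12.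
have [phi Aphi dp] := atlas_cover mfd p.
have ix := cimg_cmap dp.
have [_ _ K _ _] := atlas_chart mfd Aphi.
pose f := fun y => u1 (cinv phi y) + (- m) * u2 (cinv phi y).
have fmax : \forall y \near cmap phi p, f y <= f (cmap phi p).
  have -> : f (cmap phi p) = 0 by rewrite /f K// eq12 mulNr subrr.
  by near=> y; rewrite /f mulNr subr_le0.
have cf : C1_at f (cmap phi p).
  apply: (@C1_at_lincomb _ (- m) (u1 \o cinv phi) (u2 \o cinv phi)).
    exact: (Ck_fun_C1 mfd cu1 Aphi ix).
  exact: (Ck_fun_C1 mfd cu2 Aphi ix).
have cf2 i : differentiable (partial i f) (cmap phi p).
  apply: C1_at_diff.
  apply: (@C1_at_partial_lincomb _ i (- m) (u1 \o cinv phi) (u2 \o cinv phi)).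
  - exact: (Ck_fun_C1 mfd cu1 Aphi ix).
  - exact: (Ck_fun_C1 mfd cu2 Aphi ix).
  - exact: (Ck_fun_C1_partial mfd i cu1 Aphi ix).
  - exact: (Ck_fun_C1_partial mfd i cu2 Aphi ix).
have [f1 f2] := local_max_elliptic (principal_posdef Aphi ix) cf cf2 fmax.
have : diff_part phi f (cmap phi p) <= 0.
  rewrite /nondiv_operator [X in _ + X]big1 ?addr0// => i _.
  by rewrite f1 mulr0.
rewrite diff_part_lincomb//.
have := e1 phi p Aphi dp; rewrite LopE//= K// => E1.
have := e2 phi p Aphi dp; rewrite LopE//= K// => E2.
move: E1 E2; move: (diff_part _ _ _) (diff_part _ _ _) => P2 P1 E1 E2.
have -> : P1 = c p * u1 p - K1 * u1 p ^- 5 by rewrite -E1; ring.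
have -> : P2 = c p * u2 p - K2 * u2 p ^- 5 by rewrite -E2; ring.
have v0 := u20 p.
have -> : c p * u1 p - K1 * u1 p ^- 5 + - m * (c p * u2 p - K2 * u2 p ^- 5) =
   (m ^+ 6 * K2 - K1) * (m * u2 p) ^- 5.
  by rewrite eq12; field; rewrite !gt_eqF.
rewrite pmulr_lle0 ?subr_le0// invr_gt0 exprn_gt0// mulr_gt0//.
Unshelve. all: by end_near. Qed.

(** The set where u1 = m u2 is closed, and it is open by the strong maximum
    principle in charts. *)
Lemma strong_comparison m u1 u2 : connected [set: M] ->
  Ck_fun A 2 u1 -> Ck_fun A 2 u2 ->
  (forall phi p, A phi -> cdom phi p -> Lop g0 a c phi u1 (cmap phi p) = 0) ->
  (forall phi p, A phi -> cdom phi p -> Lop g0 a c phi u2 (cmap phi p) = 0) ->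
  (forall q, u1 q <= m * u2 q) -> (exists p, u1 p = m * u2 p) ->
  forall q, u1 q = m * u2 q.
Proof.
move=> conn cu1 cu2 e1 e2 le12 [p0 p0E].
pose Z := [set p | u1 p - m * u2 p = 0].
suff ZT : Z = [set: M].
  move=> q; have : Z q by rewrite ZT.
  by move=> /eqP; rewrite subr_eq0 => /eqP.
have zc : continuous (fun p => u1 p - m * u2 p).
  move=> p; apply: (@continuousB _ _ _ u1 (fun p => m * u2 p)).
    exact: (Ck_fun_continuous mfd cu1).
  apply: (@continuousM _ _ (fun=> m) u2); first exact: cst_continuous.
  exact: (Ck_fun_continuous mfd cu2).
apply: conn; first by exists p0; rewrite /Z/= p0E subrr.
  exists Z; last by rewrite setTI.
  rewrite openE => p Zp; rewrite /interior.
  have [phi Aphi dp] := atlas_cover mfd p.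
  have cphi := atlas_chart mfd Aphi.
  have ix := cimg_cmap dp.
  have [_ _ K _ _] := cphi.
  pose z := fun y => u1 (cinv phi y) + (- m) * u2 (cinv phi y).
  have C1z x : cimg phi x -> C1_at z x.
    move=> jx; apply: (@C1_at_lincomb _ (- m) (u1 \o cinv phi) (u2 \o cinv phi)).
      exact: (Ck_fun_C1 mfd cu1 Aphi jx).
    exact: (Ck_fun_C1 mfd cu2 Aphi jx).
  have posG y : cimg phi y -> posdef (g0 phi y).
    by move=> iy; exact: (metric_posdef riem Aphi iy).
  have C1G y i j : cimg phi y -> C1_at (fun y => g0 phi y i j) y.
    by move=> iy; exact: (metric_C1 mfd riem _ _ Aphi iy).
  have C1a y : cimg phi y -> C1_at (a \o cinv phi) y.
    by move=> iy; exact: (Ck_fun_C1 mfd (sa 1%N) Aphi iy).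
  have h : \forall y \near cmap phi p, z y = 0.
    apply: (@strong_maximum R (cimg phi) (principal phi) (drift_coef phi)
      (c \o cinv phi) z).
    - exact: (cimg_open mfd Aphi).
    - by move=> x jx; exact: principal_posdef.
    - by move=> x i j jx; exact: (continuous_principal_part posG C1G C1a).
    - by move=> x i jx; exact: (continuous_drift posG C1G C1a).
    - by move=> x jx; exact: (C1_at_continuous (Ck_fun_C1 mfd (sc 1%N) Aphi jx)).
    - exact: C1z.
    - move=> x i jx.
      apply: (@C1_at_partial_lincomb _ i (- m) (u1 \o cinv phi) (u2 \o cinv phi)).
      + exact: (Ck_fun_C1 mfd cu1 Aphi jx).
      + exact: (Ck_fun_C1 mfd cu2 Aphi jx).
      + exact: (Ck_fun_C1_partial mfd i cu1 Aphi jx).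
      + exact: (Ck_fun_C1_partial mfd i cu2 Aphi jx).
    - by move=> x _; rewrite /z mulNr subr_le0.
    - move=> x jx; rewrite -[LHS]/(diff_part phi z x) diff_part_lincomb//.
      have := e1 phi (cinv phi x) Aphi (cinv_dom cphi jx).
      have := e2 phi (cinv phi x) Aphi (cinv_dom cphi jx).
      rewrite cinvK// !LopE// /z /=.
      move: (diff_part _ _ _) (diff_part _ _ _) => P1 P2 E2 E1.
      rewrite (_ : P1 = c (cinv phi x) * u1 (cinv phi x)); last by move: E1; lra.
      rewrite (_ : P2 = c (cinv phi x) * u2 (cinv phi x)); last by move: E2; lra.
      by ring.
    - exact: ix.
    - by rewrite /z !K// mulNr.
  have h' : \forall q \near p, z (cmap phi q) = 0 by exact: (cmap_continuous cphi dp h).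
  by apply: filterS2 (near_cdom cphi dp) h' => q dq; rewrite /z K// mulNr.
exists Z; last by rewrite setTI.
apply: (@preimage_closed _ _ (fun p => u1 p - m * u2 p) [set t : R | t = 0]).
  by move=> x _; exact: zc.
exact: closed_eq.
Qed.

End Comparison.

(** The two inequalities give (m n)^6 K2 <= K2; if K2 = 0 they squeeze K1
    between 0 and 0. *)
Lemma ratio_maxima_le1 (R : realType) (K1 K2 m n : R) : 0 < m -> 0 < n ->
  0 <= K2 -> m ^+ 6 * K2 <= K1 -> n ^+ 6 * K1 <= K2 ->
  (K1 = 0 /\ K2 = 0) \/ m * n <= 1.
Proof.
move=> m0 n0; rewrite le_eqVlt => /predU1P[<-|K2_gt0] KK1 KK2.
  left; split => //; apply/eqP; rewrite eq_le.
  move: KK1 KK2; rewrite mulr0 pmulr_rle0 ?exprn_gt0// => -> ->.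
  by [].
right; rewrite -(@expr_le1 _ 6)// ?mulr_ge0 ?(ltW m0) ?(ltW n0)//.
rewrite -(ler_pM2r K2_gt0) mul1r (le_trans _ KK2)// exprMn mulrAC mulrC.
by rewrite ler_pM2l// exprn_gt0.
Qed.

(** * Uniqueness up to a factor *)

Theorem theorem4p10 (R : realType) (M : ptopologicalType)
  (A : set (chart R M)) (g0 : chart R M -> 'rV[R]_4 -> 'M[R]_4)
  (dV : {measure set (borel M) -> \bar R}) (a c u1 u2 : M -> R) :
  closed_connected_manifold A ->
  riemannian_metric A g0 ->
  riemannian_volume A g0 dV ->
  weyl_nowhere_zero A g0 ->
  smooth_fun A a -> smooth_fun A c ->
  (forall p, 0 < a p) ->
  (0 <= first_eigenvalue A g0 dV a c)%E ->
  Ck_fun A 2 u1 -> Ck_fun A 2 u2 ->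
  (forall p, 0 < u1 p) -> (forall p, 0 < u2 p) ->
  solves_equation A g0 dV a c u1 ->
  solves_equation A g0 dV a c u2 ->
  exists beta : R, 0 < beta /\ forall p, u1 p = beta * u2 p.
Proof.
move=> [_ _ cptM conn mfd] riem vol _ sa sc a0 l0 cu1 cu2 u10 u20 e1 e2.
have cu1c := Ck_fun_continuous mfd cu1.
have cu2c := Ck_fun_continuous mfd cu2.
pose K u := frakD A g0 dV a c u * int_pow_m4 dV u `^ (- (3 / 2)).
have E1 phi p : A phi -> cdom phi p -> Lop g0 a c phi u1 (cmap phi p) = K u1 * u1 p ^- 5.
  exact: e1.
have E2 phi p : A phi -> cdom phi p -> Lop g0 a c phi u2 (cmap phi p) = K u2 * u2 p ^- 5.
  exact: e2.
have K2_ge0 : 0 <= K u2.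
  rewrite /K /frakD !mulr_ge0 ?powR_ge0//.
  apply: (energy_ge0 cptM mfd riem vol) => //.
  - exact: (Ck_fun_continuous mfd (sa 0%N)).
  - exact: (Ck_fun_continuous mfd (sc 0%N)).
  - by move=> phi Aphi; exact: Ck_on_le (cu2 phi Aphi).
have ratio (u v : M -> R) : continuous u -> continuous v -> (forall p, 0 < u p) ->
    (forall p, 0 < v p) ->
    exists p, forall q, u q <= u p / v p * v q.
  move=> cu cv u0 v0.
  have [||p _ pmax] := compact_EVT_max _ cptM (f := fun p => u p / v p).
  - by exists point.
  - apply: continuous_subspaceT => p; apply: (@continuousM _ _ u (fun p => (v p)^-1)).
      exact: cu.
    by apply: continuousV (cv p); rewrite gt_eqF.
  by exists p => q; rewrite -ler_pdivrMr//; apply: pmax; rewrite inE.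
have [p pmax] := ratio u1 u2 cu1c cu2c u10 u20.
have [q qmax] := ratio u2 u1 cu2c cu1c u20 u10.
set m := u1 p / u2 p in pmax; set n := u2 q / u1 q in qmax.
have m0 : 0 < m by rewrite divr_gt0.
have n0 : 0 < n by rewrite divr_gt0.
have pE : u1 p = m * u2 p by rewrite divfK// gt_eqF.
have qE : u2 q = n * u1 q by rewrite divfK// gt_eqF.
have KK1 : m ^+ 6 * K u2 <= K u1.
  exact: (touching_coefficients mfd riem sa a0 cu1 cu2 u20 m0 E1 E2 pmax pE).
have KK2 : n ^+ 6 * K u1 <= K u2.
  exact: (touching_coefficients mfd riem sa a0 cu2 cu1 u10 n0 E2 E1 qmax qE).
exists m; split => //.
have [[K10 K20]|mn] := ratio_maxima_le1 m0 n0 K2_ge0 KK1 KK2.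
  apply: (strong_comparison mfd riem sa sc a0 conn cu1 cu2) => //; last by exists p.
  - by move=> phi r Aphi dr; rewrite E1// K10 mul0r.
  - by move=> phi r Aphi dr; rewrite E2// K20 mul0r.
(* Since m and n are maxima, u1 <= m u2 <= m n u1; m n <= 1 makes this an
   equality. *)
move=> r; apply/eqP; rewrite eq_le pmax/=.
apply: (le_trans (ler_wpM2l (ltW m0) (qmax r))).
by rewrite mulrA ler_piMl// ltW.
Qed.
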